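(* A subset $A$ of a non-discrete Polish group $X$ is (1) generically Haar-null if and only if the set $T(A):=\{\mu\in P(X):\forall x\in X\;\;\mu(A+x)=0\}$ is comeager in the space $P(X)$ of probability $\sigma$-additive Borel measures on $X$; (2) generically Haar-meager if and only if the set $K_{\mathcal M}(A):=\{K\in\mathcal K(X):\forall x\in X\;\;K\cap(A+x)\in\mathcal M_K\}$ is comeager in the hyperspace $\mathcal K(X)$; (3) generically Haar-countable if and only if the set $K_{\le\omega}(A):=\{K\in\mathcal K(X):\forall x\in X\;\;|K\cap(A+x)|\le\omega\}$ is comeager in $\mathcal K(X)$; (4) generically Haar-finite if and only if the set $K_{<\omega}(A):=\{K\in\mathcal K(X):\forall x\in X\;\;|K\cap(A+x)|<\omega\}$ is comeager in $\mathcal K(X)$; (5) generically Haar-$n$ for some (given) $n\in\mathbb N$ if and only if the set $K_{\le n}(A):=\{K\in\mathcal K(X):\forall x\in X\;\;|K\cap(A+x)|\le n\}$ is comeager in $\mathcal K(X)$.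
   Context: All groups are Abelian, written additively; a Polish group is a topological group whose underlying space is Polish. $\mathbb N=\{1,2,\dots\}$. A set is comeager if its complement is meager. $P(X)$ is the space of all $\sigma$-additive Borel probability measures on $X$ with the topology generated by the subbase of sets $\{\mu\in P(X):\mu(U)>a\}$, $U\subset X$ open, $a\in[0,1)$. For a not necessarily Borel set $S\subset X$, $\mu(S)=0$ means that $S$ is contained in a Borel set of $\mu$-measure zero. $\mathcal K(X)$ is the space of nonempty compact subsets of $X$ with the Vietoris topology. $\mathcal M_K$ is the $\sigma$-ideal of meager subsets of the space $K$. $2^\omega=\{0,1\}^\omega$ is the Cantor cube. $C(2^\omega,X)$ is the space of continuous maps $2^\omega\to X$ with the compact-open topology. For a family $\mathcal I$ of subsets of $2^\omega$, a set $A\subset X$ is generically Haar-$\mathcal I$ if $\{f\in C(2^\omega,X):\forall x\in X\;\;f^{-1}(A+x)\in\mathcal I\}$ is comeager in $C(2^\omega,X)$. The set $A$ is generically Haar-null, Haar-meager, Haar-countable, Haar-finite, Haar-$n$ if it is generically Haar-$\mathcal I$ for $\mathcal I$ respectively: the subsets of $2^\omega$ of measure zero for the standard product measure; the meager subsets; the at most countable subsets; the finite subsets; the subsets of cardinality $\le n$. *)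

(* Defs.v *)
From HB Require Import structures.
From mathcomp Require Import all_boot all_order all_algebra.
From mathcomp Require Import all_classical all_reals all_analysis.
From mathcomp Require Import measurable_realfun lra zify.

Set Implicit Arguments.
Unset Strict Implicit.
Unset Printing Implicit Defensive.

Import Order.TTheory GRing.Theory Num.Theory.

Local Open Scope classical_set_scope.
Local Open Scope ring_scope.

Definition nowhere_dense (T : topologicalType) (A : set T) :=
  interior (closure A) = set0.

Definition meager (T : topologicalType) (A : set T) :=
  exists2 F : (set T)^nat, (forall i, nowhere_dense (F i)) &
    A `<=` \bigcup_i F i.

Definition comeager (T : topologicalType) (A : set T) := meager (~` A).

Definition separable (T : topologicalType) :=
  exists2 D : set T, countable D & dense D.

Definition completely_metrizable (R : realType) (T : topologicalType) :=
  exists (M : metricType R) (f : T -> M) (g : M -> T),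
    [/\ cancel f g, cancel g f, continuous f, continuous g &
        forall F : set_system M, ProperFilter F -> cauchy F ->
          exists p : M, F --> p].

Definition polish (R : realType) (T : topologicalType) :=
  separable T /\ completely_metrizable R T.

Definition discrete_space (T : topologicalType) := forall A : set T, open A.

Notation borel X := (g_sigma_algebraType (@open X)).

Definition cylinder (n : nat) (s : nat -> bool) : set cantor_space :=
  [set t | forall i, (i < n)%N -> t i = s i].

Lemma cylinder0 s : cylinder 0 s = setT.
Proof. by rewrite -subTset. Qed.

Lemma cylinderS n s :
  cylinder n.+1 s = cylinder n s `&` (@proj nat (fun=> bool) n @^-1` [set s n]).
Proof.
apply/seteqP; split=> t /=.
  by move=> h; split => [i /ltnW|]; exact: h.
by move=> [h hn] i; rewrite ltnS leq_eqVlt => /predU1P[->|/h].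
Qed.

Lemma open_cylinder n s : open (cylinder n s).
Proof.
elim: n => [|n IHn]; first by rewrite cylinder0; exact: openT.
rewrite cylinderS; apply: openI => //.
apply: open_comp; last exact: discrete_open.
by move=> t _; exact: (@proj_continuous nat (fun=> bool)).
Qed.

Lemma nbhs_cylinder (t : cantor_space) (U : set cantor_space) :
  nbhs t U -> exists n, cylinder n t `<=` U.
Proof.
pose F := filter_from [set: nat] (fun n => cylinder n t).
have FF : Filter F.
  apply: filter_from_filter; first by exists 0%N.
  move=> i j _ _; exists (maxn i j) => // u h.
  by split=> k ki; apply: h; rewrite leq_max ki ?orbT.
suff : F --> t by move=> h /h [n _ nU]; exists n.
apply/cvg_sup => i A [_ [[C _ <-] Ct CA]].
exists i.+1 => // u h; apply: CA => /=.
by rewrite (h i).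
Qed.

Lemma open_bigcup_cylinder (U : set cantor_space) : open U ->
  U = \bigcup_(w in [set w : seq bool | cylinder (size w) (nth false w) `<=` U])
        cylinder (size w) (nth false w).
Proof.
move=> oU; apply/seteqP; split=> [t Ut|t [w /= + tw]]; last exact.
have [n nU] : exists n, cylinder n t `<=` U.
  by apply: nbhs_cylinder; exact: open_nbhs_nbhs.
exists (mkseq t n) => /=; last by rewrite size_mkseq => i ni; rewrite nth_mkseq.
apply: subset_trans nU => u; rewrite size_mkseq => h i ni.
by rewrite h// nth_mkseq.
Qed.

Lemma measurable_cylinder d (T : measurableType d) (f : T -> cantor_space) :
  (forall n s, measurable (f @^-1` cylinder n s)) ->
  measurable_fun setT (f : T -> borel cantor_space).
Proof.
move=> mf; apply: (@measurability _ _ T (borel cantor_space) setT f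
  (@open cantor_space)) => //.
move=> _ [U oU <-]; rewrite setTI (open_bigcup_cylinder oU) preimage_bigcup.
rewrite bigcup_mkcond; apply: countable_bigcupT_measurable => // w.
by case: ifPn => // _; exact: mf.
Qed.

Section coin_measure.
Variable R : realType.

Definition binary_digits (x : measurableTypeR R) : cantor_space :=
  fun i => odd (Num.truncn (2 ^+ i.+1 * x)).

Let k (s : nat -> bool) :=
  fix k n := if n is m.+1 then (s m + (k m).*2)%N else 0%N.

Let truncn_half (y : R) : 0 <= y -> Num.truncn y = (Num.truncn (2 * y))./2.
Proof.
move=> y0; apply: truncn_def.
have /truncn_itv/andP[] : 0 <= 2 * y by rewrite mulr_ge0.
set m := Num.truncn _; rewrite -{1 2}(odd_double_half m) => h1 h2.
have ub : (odd m)%:R <= 1 :> R by case: (odd m).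
have lb : 0 <= (odd m)%:R :> R by case: (odd m).
move: h1 h2; rewrite -addn1 -muln2 !natrD natrM => h1 h2.
rewrite -addn1 natrD; apply/andP; split; lra.
Qed.

Let cylinder_truncn (s : nat -> bool) n x : 0 <= x < 1 ->
  cylinder n s (binary_digits x) <-> Num.truncn (2 ^+ n * x) = k s n.
Proof.
move=> /andP[x0 x1]; elim: n => [|n IHn].
  rewrite cylinder0 expr0 mul1r; split => //= _.
  by apply: truncn_def; rewrite x0.
rewrite cylinderS; split=> /=.
  move=> [/IHn h1 h2]; rewrite -(odd_double_half (Num.truncn _)).
  rewrite exprS -mulrA -truncn_half ?mulr_ge0// h1; congr (nat_of_bool _ + _)%N.
  by rewrite mulrA -exprS.
move=> h; split; last first.
  by rewrite /proj /binary_digits h oddD odd_double addbF oddb.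
apply/IHn; rewrite truncn_half ?mulr_ge0 ?exprn_ge0// mulrA -exprS h.
by rewrite half_bit_double.
Qed.

Let preimage_cylinder n s :
  binary_digits @^-1` cylinder n s `&` `[0, 1[ =
  [set` `[(k s n)%:R / 2 ^+ n, (k s n).+1%:R / 2 ^+ n[ ] `&` `[0, 1[ :> set R.
Proof.
apply/seteqP; split => x [/= h]; rewrite in_itv/= => x01; split => //.
  move/(cylinder_truncn s n x01) : h => <-.
  rewrite in_itv/= ler_pdivrMr ?ltr_pdivlMr ?exprn_gt0// mulrC.
  apply: truncn_itv; rewrite mulr_ge0 ?exprn_ge0//; by case/andP : x01.
apply/(cylinder_truncn s n x01); apply: truncn_def.
by move: h; rewrite in_itv/= ler_pdivrMr ?ltr_pdivlMr ?exprn_gt0// mulrC.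
Qed.

Let k_lt s n : (k s n < 2 ^ n)%N.
Proof.
elim: n => //= n IHn; rewrite expnS mul2n -addnn.
by have := leq_add IHn IHn; case: (s n); rewrite -addnn; lia.
Qed.

Let measurable_truncn (c : R) m :
  measurable [set x : R | (Num.truncn (c * x) <= m)%N].
Proof.
rewrite (_ : [set x | _] = ( *%R c) @^-1` `]-oo, m.+1%:R[).
  have mc : measurable_fun setT ( *%R c) by exact: mulrl_measurable.
  by rewrite -[X in measurable X]setTI; apply: mc => //; exact: measurable_itv.
by apply/seteqP; split=> x /=; rewrite in_itv/= truncn_le_nat.
Qed.

Let measurable_odd_truncn (c : R) :
  measurable [set x : R | odd (Num.truncn (c * x))].
Proof.
rewrite (_ : [set x | _] = \bigcup_(m in [set m | odd m])
    ([set x : R | (Num.truncn (c * x) <= m)%N] `\`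
     [set x : R | (Num.truncn (c * x) <= m.-1)%N])).
  by apply: bigcup_measurable => m _; exact: measurableD.
apply/seteqP; split=> [x /= ox|x [[|m]//= om]].
  exists (Num.truncn (c * x)) => //=; split => //=.
  by case: (Num.truncn _) ox => //= m _; rewrite ltnn.
by move=> [/=] h1 h2; suff -> : Num.truncn (c * x) = m.+1 by []; lia.
Qed.

Let measurable_binary_digits :
  measurable_fun setT (binary_digits : measurableTypeR R -> borel cantor_space).
Proof.
apply: measurable_cylinder => n s; elim: n => [|n IHn].
  by rewrite cylinder0 preimage_setT.
rewrite cylinderS preimage_setI; apply: measurableI => //.
have mo := measurable_odd_truncn (2 ^+ n.+1).
case: (s n); first by [].
rewrite (_ : _ @^-1` _ = ~` [set x : R | odd (Num.truncn (2 ^+ n.+1 * x))]).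
  exact: measurableC.
apply/seteqP; split=> x /=; rewrite /proj /binary_digits; first by move=> ->.
by move/negP/negbTE.
Qed.

HB.instance Definition _ := isMeasurableFun.Build _ _ _ _
  (binary_digits : measurableTypeR R -> borel cantor_space)
  measurable_binary_digits.

Lemma measurable_unit : measurable (`[0, 1[ : set R).
Proof. exact: measurable_itv. Qed.

Definition unit_prob := mrestr (@lebesgue_measure R) measurable_unit.
HB.instance Definition _ := Measure.on unit_prob.

Let unit_probT : unit_prob setT = 1%E.
Proof.
by rewrite /unit_prob /mrestr setTI lebesgue_measure_itv/= lte_fin ltr01 sube0.
Qed.
HB.instance Definition _ := Measure_isProbability.Build _ _ _
  unit_prob unit_probT.

(* The standard product measure on the Cantor cube: a cylinder fixing
   the first n coordinates has measure 2^-n. It exists (binary digits of a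
   uniform real number) and these values determine it. *)
Definition is_coin_measure (mu : probability (borel cantor_space) R) :=
  forall n (s : nat -> bool), mu (cylinder n s) = (2^-1 ^+ n)%:E.

Lemma coin_measure_exists : exists mu, is_coin_measure mu.
Proof.
exists (distribution unit_prob
  (binary_digits : {mfun _ >-> borel cantor_space})).
move=> n s; rewrite /distribution /pushforward /= /unit_prob /mrestr.
rewrite preimage_cylinder setIidl; last first.
  move=> x /=; rewrite !in_itv/= => /andP[h1 h2]; apply/andP; split.
    by apply: le_trans h1; rewrite divr_ge0// exprn_ge0.
  apply: lt_le_trans h2 _; rewrite ler_pdivrMr ?exprn_gt0// mul1r.
  by rewrite -natrX ler_nat k_lt.
rewrite lebesgue_measure_itv/= lte_fin ltr_pM2r
  ?invr_gt0 ?exprn_gt0// ltr_nat ltnSn.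
by rewrite -EFinB -mulrBl -natrB// subSnn mul1r exprVn.
Qed.

Lemma coin_measure_unique mu nu : is_coin_measure mu -> is_coin_measure nu ->
  forall A : set (borel cantor_space), measurable A -> mu A = nu A.
Proof.
move=> hmu hnu.
pose G := [set A | A = set0 \/ exists n s, A = cylinder n s].
move=> A mA.
apply: (@measure_unique _ R (borel cantor_space) G (fun=> setT)
  _ _ _ _ mu nu _ _ A mA).
- apply/seteqP; split.
    apply: smallest_sub; first exact: smallest_sigma_algebra.
    move=> U /open_bigcup_cylinder ->; rewrite bigcup_mkcond.
    apply: (@countable_bigcupT_measurable _ (g_sigma_algebraType G)) => // w.
    case: ifPn => // _; apply: sub_sigma_algebra; right.
    by exists (size w), (nth false w).
  apply: smallest_sub; first exact: sigma_algebra_measurable.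
  move=> _ [->|[n [s ->]]]; first exact: measurable0.
  by apply: sub_sigma_algebra; exact: open_cylinder.
- have GI n s m t : (n <= m)%N -> G (cylinder n s `&` cylinder m t).
    move=> nm; have [h|h] := pselect (cylinder n s t).
      right; exists m, t; apply/setIidPr => u ut i ni.
      by rewrite ut ?h// (leq_trans ni).
    left; rewrite -subset0 => u [us ut]; apply: h => i ni.
    by rewrite -us// ut// (leq_trans ni).
  move=> _ _ [->|[n [s ->]]] [->|[m [t ->]]]; rewrite ?set0I ?setI0;
    try by left.
  by have [nm|/ltnW mn] := leqP n m; [exact: GI|rewrite setIC; exact: GI].
- by move=> _; right; exists 0%N, (fun=> false); rewrite cylinder0.
- by rewrite -subTset => x _; exists 0%N.
- move=> _ [->|[n [s ->]]]; first by rewrite !measure0.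
  exact: (etrans (hmu n s) (esym (hnu n s))).
- move=> _; apply: le_lt_trans (probability_le1 mu measurableT) _.
  exact: ltry.
Qed.

Definition coin_measure : probability (borel cantor_space) R :=
  projT1 (cid coin_measure_exists).

Lemma coin_measureP : is_coin_measure coin_measure.
Proof. exact: projT2 (cid coin_measure_exists). Qed.

End coin_measure.

Definition translate (X : zmodType) (A : set X) (x : X) : set X :=
  [set a + x | a in A].

(* Measurable types are pointed but topological groups are not canonically so:
   this copy of X, pointed by 0, is where Borel measures on X live. *)
Definition pointed_group (X : topologicalZmodType) : Type := X.
HB.instance Definition _ (X : topologicalZmodType) :=
  TopologicalZmodule.on (pointed_group X).
HB.instance Definition _ (X : topologicalZmodType) :=
  isPointed.Build (pointed_group X) (0 : X).

(* A probability also has (irrelevant) values on non-Borel sets. Two points that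
   agree on Borel sets have the same neighbourhoods, so meagerness of a set
   that only depends on Borel values is not affected. *)
Definition prob_space (R : realType) (X : topologicalZmodType) : Type :=
  probability (borel (pointed_group X)) R.
HB.instance Definition _ (R : realType) (X : topologicalZmodType) :=
  Choice.on (prob_space R X).

Definition prob_subbase (R : realType) (X : topologicalZmodType) :
    set_system (prob_space R X) :=
  [set V | exists (U : set X) (a : R),
    [/\ open U, 0 <= a < 1 & V = [set mu : prob_space R X | (a%:E < mu U)%E]]].

HB.instance Definition _ (R : realType) (X : topologicalZmodType) :=
  isSubBaseTopological.Build (prob_space R X) (@prob_subbase R X) id.

Definition hyperspace (X : topologicalType) : Type :=
  {K : set X | compact K /\ K !=set0}.
HB.instance Definition _ (X : topologicalType) := gen_eqMixin (hyperspace X).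
HB.instance Definition _ (X : topologicalType) :=
  gen_choiceMixin (hyperspace X).

Definition vietoris_subbase (X : topologicalType) : set_system (hyperspace X) :=
  [set V | exists2 U : set X, open U &
    V = [set K : hyperspace X | sval K `<=` U] \/
    V = [set K : hyperspace X | sval K `&` U !=set0]].

HB.instance Definition _ (X : topologicalType) :=
  isSubBaseTopological.Build (hyperspace X) (@vietoris_subbase X) id.

Definition cantor_maps (X : topologicalType) : Type :=
  continuousType cantor_space X.
HB.instance Definition _ (X : topologicalType) := Choice.on (cantor_maps X).
HB.instance Definition _ (X : topologicalType) :=
  Topological.copy (cantor_maps X)
    (@initial_topology (continuousType cantor_space X)
       {compact-open, cantor_space -> X} (fun f => f)).

Section generically_Haar.
Variables (X : topologicalZmodType) (A : set X).

Definition generically_Haar (I : set_system cantor_space) :=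
  comeager [set f : cantor_maps X |
    forall x : X, I ((f : cantor_space -> X) @^-1` translate A x)].

Definition generically_Haar_null (R : realType) :=
  generically_Haar (coin_measure R).-negligible.

Definition generically_Haar_meager :=
  generically_Haar [set B | meager B].

Definition generically_Haar_countable :=
  generically_Haar [set B | countable B].

Definition generically_Haar_finite :=
  generically_Haar [set B | finite_set B].

Definition generically_Haar_n (n : nat) :=
  generically_Haar [set B | (B #<= `I_n)%card].

Definition null_measures (R : realType) : set (prob_space R X) :=
  [set mu : prob_space R X | forall x : X, mu.-negligible (translate A x)].

(* set_val @^-1` B is the trace of B on K, as a subset of the subspace K. *)
Definition compacts_meager : set (hyperspace X) :=
  [set K : hyperspace X | forall x : X,
    meager (set_val @^-1` translate A x : set (set_type (sval K)))].

Definition compacts_countable : set (hyperspace X) :=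
  [set K : hyperspace X | forall x : X, countable (sval K `&` translate A x)].

Definition compacts_finite : set (hyperspace X) :=
  [set K : hyperspace X | forall x : X, finite_set (sval K `&` translate A x)].

Definition compacts_le (n : nat) : set (hyperspace X) :=
  [set K : hyperspace X | forall x : X,
    (sval K `&` translate A x #<= `I_n)%card].

End generically_Haar.

Arguments null_measures {X} A R.

(* Main.v *)
Require Import Defs.
From mathcomp Require Import all_boot all_order all_algebra.
From mathcomp Require Import all_classical all_reals all_analysis.
From mathcomp Require Import finmap ring lra zify.

Set Implicit Arguments.
Unset Strict Implicit.
Unset Printing Implicit Defensive.

Import Order.TTheory GRing.Theory Num.Theory.

Local Open Scope classical_set_scope.
Local Open Scope ring_scope.

(** Both sides of each equivalence are games of the same kind, and the proof plays
    them simultaneously. A condition consists of a level [n] and pairwise disjoint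
    nonempty open cells, indexed by words of [n] bits; a condition refines another
    if the cell of each longer word has its closure in the cell of its prefix. A
    descending sequence of conditions with small cells is a Cantor scheme, and it
    converges to a map [F] on the Cantor cube.

    A condition also determines an open box in each of the spaces to be compared:
    the continuous maps that send each cylinder to its cell; the compact sets that
    meet all the cells and lie in their union; the probabilities that give every
    cell more than [2^-n]. In each space the boxes are so fine that any open set
    meeting the box of a condition contains the box of a refinement of it. Two
    consequences follow. The dense open sets of one space can be entered by refining
    conditions. And, by the maximal disjoint families of the Banach-Mazur game
    ([comeager_descending]), comeager many points of the other space lie in all the
    boxes of a descending sequence that enters given dense open sets of the first.
    So if a property is comeager in one space, then comeager many points of the other
    space are linked by a descending sequence to a point with this property, and it
    remains to compare two linked points.

    For maps and compact sets ([generically_Haar_hyperspace]) linked points are an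
    injective continuous map and its range; since the map is a homeomorphism onto
    its range, it exchanges the meager, countable, finite or [n]-element subsets of
    the cube with those of the range.

    For measures a difficulty arises: the image of the coin measure under a
    continuous map of the cube has compact support, while a typical probability on
    [X] need not. Therefore the word [0...0] of each level carries no cell. The limit
    map [F] is then continuous except at the sequence [000...], the
    mass [2^-n] of the free word leaves enough room for the boxes of
    probabilities to be nonempty and open, and a measure in all the boxes dominates
    the image of the coin measure on images of closed sets ([limit_domination]). The
    part of [F] on each cylinder of [0^i 1] is a continuous map of a Cantor cube.
    From maps to measures, all these parts are made generic at once, and the
    regularity of the coin measure turns null preimages of an arbitrary set into
    a null set of the measure ([limit_negligible]). From measures to maps, a generic
    map is the part of [F] on the cylinder of [1], and the image of the coin measure
    under [F] is the measure to which the hypothesis applies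
    ([negligible_first_track]). That the boxes of probabilities are fine enough
    ([measure_refinement]) rests on approximating a probability by empirical
    measures with [2^N] atoms, adapted to the cells already fixed ([allocation]). *)

(** * Category and descending sequences of conditions *)

Lemma comeagerS (T : topologicalType) (A B : set T) :
  A `<=` B -> comeager A -> comeager B.
Proof.
by move=> AB [F nF AF]; exists F => // x nBx; apply: AF => /AB.
Qed.

Lemma comeager_bigcap_open (T : topologicalType) (A : set T) :
  comeager A -> exists2 D : (set T)^nat,
    forall k, open (D k) /\ dense (D k) & \bigcap_k D k `<=` A.
Proof.
move=> [F nF AF]; exists (fun k => ~` closure (F k)); last first.
  move=> x Dx; apply: contrapT => /AF[k _ Fkx].
  by have := Dx k I; apply; exact: subset_closure.
move=> k; split; first by apply: closed_openC; exact: closed_closure.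
move=> O [y Oy] oO; apply: contrapT => /set0P/negP; rewrite negbK => /eqP O0.
have : interior (closure (F k)) y.
  rewrite /interior; apply: (filterS _ (open_nbhs_nbhs (conj oO Oy))) => z Oz.
  by apply: contrapT => cz; have : set0 z by rewrite -O0.
by rewrite nF.
Qed.

Lemma nowhere_denseC (T : topologicalType) (D : set T) :
  open D -> dense D -> nowhere_dense (~` D).
Proof.
move=> oD dD; rewrite /nowhere_dense -subset0 => y iy.
have [z []] := dD _ (ex_intro _ y iy) (open_interior _).
move=> /interior_subset /[swap] Dz /(_ _ (open_nbhs_nbhs (conj oD Dz))).
by move=> [x []].
Qed.

Section descending.
Variables (Y : topologicalType) (Q : Type) (le : Q -> Q -> Prop).
Variables (V : Q -> set Y) (D : nat -> set Q) (top : Q).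
Hypothesis le_trans : forall p q r, le p q -> le q r -> le p r.
Hypothesis oV : forall q, open (V q).
Hypothesis V0 : forall q, V q !=set0.
Hypothesis leV : forall p q, le p q -> V p `<=` V q.
Hypothesis topV : V top = setT.
Hypothesis refineV : forall q O, open O -> O `&` V q !=set0 ->
  exists2 p, le p q & V p `<=` O.
Hypothesis refineD : forall k q, exists2 p, le p q & D k p.

Let below k (E : set Q) := [set p | D k p /\ exists2 q, E q & le p q].

Let fam := fix fam k : set Q := sval (ex_maximal_disjoint_subcollection V
  (below k (if k is j.+1 then fam j else [set top]))).

Let pre k := if k is j.+1 then fam j else [set top].

Let famP k : maximal_disjoint_subcollection V (fam k) (below k (pre k)).
Proof. by case: k => [|k] /=; case: (ex_maximal_disjoint_subcollection _ _). Qed.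

Let dense_pre_fam k : dense (\bigcup_(q in pre k) V q) ->
  dense (\bigcup_(q in fam k) V q).
Proof.
move=> dk O O0 oO; apply: contrapT => nO.
have [y [Oy [q Eq Vqy]]] := dk O O0 oO.
have [p pq pO] := refineV oO (ex_intro _ y (conj Oy Vqy)).
have [r rp Dr] := refineD k p.
have [famB tfam maxfam] := famP k.
have rO : V r `<=` O by apply: subset_trans pO; exact: leV.
have [z Vrz] := V0 r.
have nfamr s : fam k s -> V s `&` V r = set0.
  move=> fs; apply/eqP; apply: contrapT => /negP/set0P[x [Vsx Vrx]].
  by apply: nO; exists x; split; [exact: rO|exists s].
apply: (maxfam (fam k `|` [set r])).
- split=> [s fs|h]; first by left.
  have /nfamr : fam k r by apply: h; right.
  by rewrite setIid => Vr0; move: Vrz; rewrite Vr0.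
- move=> s [/famB//|->]; split => //; exists q => //.
  exact: le_trans rp pq.
- move=> s s' [fs|->] [fs'|->] //=; first exact: tfam.
    by rewrite nfamr// => -[].
  by rewrite setIC nfamr// => -[].
Qed.

Let dense_fam k : dense (\bigcup_(q in fam k) V q).
Proof.
elim: k => [|k IHk]; apply: dense_pre_fam => //=.
by rewrite bigcup_set1 topV => O [y Oy] _; exists y.
Qed.

(** The strategy argument for the Banach-Mazur game. A maximal disjoint
   subfamily of the sets [V p] with [p] in [D k] below the previous family has a
   dense open union; a point in all these unions lies in exactly one member of
   each family, and these members form a descending sequence. *)
Lemma comeager_descending : comeager [set y | exists q : nat -> Q,
  forall k, [/\ le (q k.+1) (q k), D k (q k) & V (q k) y]].
Proof.
exists (fun k => ~` (\bigcup_(q in fam k) V q)) => [k|y /= ny].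
  apply: nowhere_denseC; last exact: dense_fam.
  by apply: bigcup_open => q _; exact: oV.
apply: contrapT => hy; apply: ny.
have ay k : exists q, fam k q /\ V q y.
  apply: contrapT => nq; apply: hy; exists k => // -[q fq Vq].
  by apply: nq; exists q.
exists (fun k => sval (cid (ay k))) => k.
case: (cid (ay k)) => q /= [fq Vq]; case: (cid (ay k.+1)) => p /= [fp Vp].
have [/(_ _ fq)[Dq _] tfam _] := famP k.
have [/(_ _ fp)[_ [r fr lepr]] _ _] := famP k.+1.
split => //; suff -> : q = r by [].
by apply: tfam => //; exists y; split => //; exact: leV Vp.
Qed.

End descending.

(** * Conditions: finite levels of a Cantor scheme *)

(** Words address cylinders, and [prepend u] identifies the whole Cantor cube with
    the cylinder of [u]. *)
Definition prepend (u : seq bool) (t : cantor_space) : cantor_space :=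
  fun i => if (i < size u)%N then nth false u i else t (i - size u)%N.

Lemma mkseq_prepend_long u t n : (size u <= n)%N ->
  mkseq (prepend u t) n = u ++ mkseq t (n - size u).
Proof.
move=> un; apply: (@eq_from_nth _ false) => [|i].
  by rewrite size_cat !size_mkseq subnKC.
rewrite size_mkseq => ni; rewrite nth_mkseq// nth_cat /prepend.
by case: ltnP => // ui; rewrite nth_mkseq//; lia.
Qed.

Lemma take_mkseq (t : nat -> bool) m n : (m <= n)%N ->
  take m (mkseq t n) = mkseq t m.
Proof. by move=> mn; rewrite /mkseq -map_take take_iota (minn_idPl mn). Qed.

Lemma cylinderE n (s t : cantor_space) : cylinder n s t <-> mkseq t n = mkseq s n.
Proof.
split=> [h|h i ni].
  by apply/eq_in_map => i; rewrite mem_iota add0n => /andP[_]; exact: h.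
by have := congr1 (nth false ^~ i) h; rewrite !nth_mkseq.
Qed.

(** The uses made below of a complete metric, when [sm k S] is read as the bound
    [2^-k] on the distances between points of [S]. Fixing the scale and forgetting
    the metric avoids carrying along a homeomorphism with a metric space. *)
Record complete_scale (X : topologicalType) (sm : nat -> set X -> Prop) : Prop := {
  scale_anti : forall j k S, (j <= k)%N -> sm k S -> sm j S;
  scale_refine : forall k (x : X) O, open O -> O x ->
    exists U, [/\ open U, U x, closure U `<=` O & sm k U];
  scale_nbhs : forall (x : X) O, open O -> O x ->
    exists k, forall S, sm k S -> S x -> S `<=` O;
  scale_complete : forall S : (set X)^nat, (forall k, S k !=set0) ->
    (forall k, closure (S k.+1) `<=` S k) -> (forall k, sm k (S k)) ->
    exists x, forall k, S k x }.

Lemma completely_metrizable_scale (R : realType) (X : topologicalType) :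
  completely_metrizable R X ->
  hausdorff_space X /\ exists sm, @complete_scale X sm.
Proof.
move=> [M [f [g [fK gK cf cg cM]]]]; split.
  move=> x y xy; rewrite -(fK x) -(fK y); congr g; apply: metric_hausdorff.
  move=> A B /cf fA /cf fB; have [z [Az Bz]] := xy _ _ fA fB.
  by exists (f z).
pose e k : R := 2^-1 ^+ k.
have e0 k : 0 < e k by rewrite exprn_gt0// invr_gt0.
have eE k : e k = e k.+1 + e k.+1 by rewrite /e exprS; lra.
have e_le j k : (j <= k)%N -> e k <= e j.
  by move=> jk; apply: ler_wiXn2l => //; rewrite ?invr_ge0// invf_le1 ?ler1n.
have e_lt (d : R) : 0 < d -> exists k, e k < d.
  move=> d0; exists (Num.truncn d^-1).+1; rewrite /e exprVn invf_plt ?posrE ?exprn_gt0//.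
  by apply: lt_trans (truncnS_gt _) _; rewrite -natrX ltr_nat; exact: ltn_expl.
pose sm k (S : set X) := forall x y, S x -> S y -> mdist (f x) (f y) < e k.
have nb (x : X) O : open O -> O x -> exists k, [set y | mdist (f x) (f y) < e k] `<=` O.
  move=> oO Ox; have : nbhs (f x) (g @^-1` O).
    by apply: cg; rewrite fK; exact: open_nbhs_nbhs.
  move=> /nbhs_ballP[d d0]; rewrite ballEmdist => dO.
  have [k kd] := e_lt _ d0; exists k => y /= xy.
  by rewrite -(fK y); apply: dO => /=; exact: lt_trans kd.
exists sm; split.
- move=> j k S jk h x y Sx Sy; apply: lt_le_trans (h _ _ Sx Sy) _; exact: e_le.
- move=> k x O oO Ox; have [j jO] := nb _ _ oO Ox.
  pose i := (maxn j k).+1.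
  have ei : e i + e i <= e j /\ e i + e i <= e k.
    by rewrite -eE; split; apply: e_le; rewrite ?leq_maxl ?leq_maxr.
  have oB z r : nbhs z [set y | mdist (f z) (f y) < r] \/ r <= 0.
    have [r0|] := ltP 0 r; last by right.
    left; rewrite (_ : [set y | _] = f @^-1` (ball (f z) r)).
      by apply: cf; exact: nbhsx_ballx.
    by rewrite ballEmdist.
  exists (interior [set y | mdist (f x) (f y) < e i]); split.
  + exact: open_interior.
  + rewrite /interior; case: (oB x (e i)) => //.
    by move=> /(lt_le_trans (e0 i)); rewrite ltxx.
  + move=> y cy; apply: jO => /=.
    case: (oB y (e i)) => [|/(lt_le_trans (e0 i))]; last by rewrite ltxx.
    move=> /cy[z [/interior_subset/= xz yz]].
    apply: le_lt_trans (metric_triangle _ (f z) _) _.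
    by apply: lt_le_trans ei.1; rewrite ltrD// metric_sym.
  + move=> y z /interior_subset/= xy /interior_subset/= xz.
    apply: le_lt_trans (metric_triangle _ (f x) _) _.
    by apply: lt_le_trans ei.2; rewrite ltrD// metric_sym.
- move=> x O oO Ox; have [k kO] := nb _ _ oO Ox; exists k => S sS Sx y Sy.
  by apply: kO; exact: sS.
- move=> S S0 cS sS.
  have leS j k : (j <= k)%N -> S k `<=` S j.
    elim: k => [|k IHk]; first by rewrite leqn0 => /eqP ->.
    rewrite leq_eqVlt => /predU1P[->//|/IHk]; apply: subset_trans.
    by apply: subset_trans (cS k); exact: subset_closure.
  pose G := filter_from [set: nat] (fun k => f @` S k).
  have FG : ProperFilter G.
    apply: filter_from_proper; last by move=> k _; have [x Sx] := S0 k; exists (f x), x.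
    apply: filter_from_filter; first by exists 0%N.
    move=> i j _ _; exists (maxn i j) => // _ [x Sx <-].
    by split; exists x => //; apply: leS Sx; rewrite ?leq_maxl ?leq_maxr.
  have /cM[] : cauchy G.
    move=> E; rewrite nbhs_simpl /= -entourage_ballE => -[d d0 dE].
    have [k kd] := e_lt _ d0.
    exists (f @` S k, f @` S k) => /=; first by split; exists k.
    move=> [_ _] /= [[x Sx <-] [y Sy <-]]; apply: dE => /=.
    by rewrite ballEmdist /=; apply: lt_trans kd; exact: sS.
  move=> p Gp; exists (g p) => k; apply: cS => B /cg /= gB.
  have [j _ jB] : G (g @^-1` B) by apply: Gp.
  have [x Sx] := S0 (maxn j k.+1); exists x; split.
    by apply: leS Sx; rewrite leq_maxr.
  have : (g @^-1` B) (f x) by apply: jB; exists x => //; apply: leS Sx; rewrite leq_maxl.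
  by rewrite /= fK.
Qed.

Lemma hausdorff_closed1 (X : topologicalType) (x : X) :
  hausdorff_space X -> closed [set x].
Proof. by move=> hX; apply: accessible_closed_set1; exact: hausdorff_accessible. Qed.

Lemma open_setD (X : topologicalType) (A B : set X) :
  open A -> closed B -> open (A `\` B).
Proof. by move=> oA cB; rewrite setDE; apply: openI => //; exact: closed_openC. Qed.

(** Induction on the family. A point [x] is chosen for the first member and removed
    from the other ones, which remain nonempty since no point is open; as the others
    shrink to sets whose closures miss [x], a small neighbourhood of [x] is left. *)
Lemma disjoint_shrinking (X : topologicalType) (sm : nat -> set X -> Prop)
    (T : choiceType) (s : seq T) (k : nat) (O : T -> set X) :
  complete_scale sm -> hausdorff_space X -> (forall x : X, ~ open [set x]) ->
  uniq s -> (forall t, t \in s -> open (O t) /\ O t !=set0) ->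
  exists U : T -> set X,
    (forall t, t \in s ->
      [/\ open (U t), U t !=set0, closure (U t) `<=` O t & sm k (U t)]) /\
    (forall t t', t \in s -> t' \in s -> U t `&` U t' !=set0 -> t = t').
Proof.
move=> scX hX noiso; elim: s O => [|t s IHs] O; first by move=> _ _; exists O.
move=> /= /andP[ts us] hO.
have [oOt [x Ox]] := hO t (mem_head _ _).
have hW t' : exists W, t' \in s ->
    [/\ open W, W !=set0, closure W `<=` O t' & ~ closure W x].
  case: (boolP (t' \in s)) => ts'; last by exists set0.
  have [oO [z Oz]] := hO t' (@mem_behead _ (t :: s) _ ts').
  have [y [Oy yx]] : exists y, O t' y /\ y <> x.
    apply: contrapT => h; apply: (noiso z).
    rewrite (_ : [set z] = O t')//; apply/seteqP; split=> [_ ->//|y Oy].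
    by apply: contrapT => yz; apply: h; have [zx|zx] := pselect (z = x);
      [exists y; split => // yx; apply: yz; rewrite yx zx|exists z].
  have oOx : open (O t' `\` [set x]).
    by apply: open_setD => //; exact: hausdorff_closed1.
  have [W [oW Wy cW _]] := scale_refine scX 0 oOx (conj Oy yx).
  exists W; split => //; [by exists y|by move=> z' /cW[]|by move=> /cW[_]; exact].
pose W t' := sval (cid (hW t')).
have WP t' : t' \in s -> [/\ open (W t'), W t' !=set0, closure (W t') `<=` O t' &
    ~ closure (W t') x] by rewrite /W; case: (cid (hW t')).
have [|U [hU dU]] := IHs W us; first by move=> t' /WP[].
pose C := \big[setU/set0]_(t' <- s) closure (W t').
have cC : closed C by apply: closed_bigsetU => t' _; exact: closed_closure.
have CP y : C y <-> exists2 t', t' \in s & closure (W t') y.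
  by rewrite /C -bigcup_seq; split=> -[t' st' h]; exists t'.
have [|Ut [oUt Utx cUt sUt]] := scale_refine scX k (open_setD oOt cC) (x := x).
  by split => // /CP[t' /WP[_ _ _]].
have dUt t' : t' \in s -> ~ (Ut `&` U t' !=set0).
  move=> st' [y [/subset_closure/cUt[_ nCy] Uy]]; apply: nCy; apply/CP.
  exists t' => //; have [_ _ cU _] := hU _ st'.
  by apply/subset_closure/cU/subset_closure.
exists (fun t' => if t' == t then Ut else U t'); split => [t'|t1 t2].
  rewrite inE; case: eqVneq => [-> _|_ /= st'].
    by split => //; [exists x|move=> y /cUt[]].
  have [oU U0 cU sU] := hU _ st'; split => //.
  by have [_ _ cW _] := WP _ st'; move=> y /cU /subset_closure/cW.
rewrite !inE; case: (eqVneq t1 t) => [->|_]; case: (eqVneq t2 t) => [->|_] //=.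
- by move=> _ st2 /dUt; case.
- by move=> st1 _; rewrite setIC => /dUt; case.
- exact: dU.
Qed.

Section conditions.
Variables (X : topologicalType) (sm : nat -> set X -> Prop).
Hypotheses (scX : complete_scale sm) (hX : hausdorff_space X).
Hypothesis noiso : forall x : X, ~ open [set x].
(** The words that carry a cell, closed under extension: all of them for
    compact sets, those other than [0...0] for measures, where the mass above
    [0^n] is left free at level [n]. *)
Variable P : pred (seq bool).
Hypothesis P_cat : forall u v, P u -> P (u ++ v).

Record condition := Condition {
  level : nat;
  cell : seq bool -> set X;
  cell_open : forall w, open (cell w);
  cell_neq0 : forall w, cell w !=set0;
  cell_free : forall w, ~~ P w -> cell w = setT;
  cell_disjoint : forall w w', size w = level -> size w' = level ->
    P w -> P w' -> cell w `&` cell w' !=set0 -> w = w' }.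

(** The closures make the cells along a branch a Cauchy filter with a limit in all of
    them. A word without a cell has the whole space as its cell, so that refinement
    need not mention the words that carry one. *)
Definition refines (p q : condition) := (level q <= level p)%N /\
  forall w, size w = level p -> closure (cell p w) `<=` cell q (take (level q) w).

Definition small k (q : condition) := (k <= level q)%N /\
  forall w, size w = level q -> P w -> sm k (cell q w).

Lemma refines_cell p q w : refines p q -> size w = level p ->
  cell p w `<=` cell q (take (level q) w).
Proof. by move=> [_ h] /h; apply: subset_trans; exact: subset_closure. Qed.

Lemma refines_trans p q r : refines p q -> refines q r -> refines p r.
Proof.
move=> pq qr; split; first exact: leq_trans qr.1 pq.1.
move=> w sw; apply: subset_trans (pq.2 w sw) _.
have := refines_cell qr (w := take (level q) w); rewrite take_takel ?qr.1//.
by apply; rewrite size_takel// sw pq.1.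
Qed.

Lemma trivial_condition_exists : [set: X] !=set0 -> exists q : condition,
  level q = 0 /\ cell q = fun=> setT.
Proof.
move=> X0.
have d0 (w w' : seq bool) : size w = 0 -> size w' = 0 -> P w -> P w' ->
    [set: X] `&` setT !=set0 -> w = w'.
  by move=> /size0nil -> /size0nil ->.
by exists (@Condition 0 (fun=> setT) (fun=> openT) (fun=> X0)
  (fun _ _ => erefl) d0).
Qed.

(** The source of all density arguments: since no point is isolated, pairwise
    disjoint cells can meet any open constraints at the words of a deeper level. *)
Lemma refinement (q : condition) N k (G : seq bool -> set X) :
  (level q <= N)%N -> (k <= N)%N ->
  (forall w, size w = N -> P w ->
     open (G w) /\ G w `&` cell q (take (level q) w) !=set0) ->
  exists p, [/\ refines p q, level p = N, small k p &
    forall w, size w = N -> P w -> cell p w `<=` G w].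
Proof.
move=> qN kN hG.
pose s := [seq w <- [seq tval t | t : N.-tuple bool] | P w].
have sP w : (w \in s) = (size w == N) && P w.
  rewrite mem_filter andbC; congr (_ && _); apply/mapP/eqP => [[t _ ->]|sw].
    by rewrite size_tuple.
  by exists (tcast sw (in_tuple w)); rewrite ?mem_enum// val_tcast.
have us : uniq s by rewrite filter_uniq// map_inj_uniq ?enum_uniq//; exact: val_inj.
pose O w := G w `&` cell q (take (level q) w).
have [|U [hU dU]] := disjoint_shrinking k scX hX noiso us (O := O).
  move=> w; rewrite sP => /andP[/eqP sw Pw]; have [oG G0] := hG _ sw Pw.
  by split => //; apply: openI => //; exact: cell_open.
have X0 : [set: X] !=set0 by have [x _] := cell_neq0 q [::]; exists x.
pose U' w := if w \in s then U w else setT.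
have oU' w : open (U' w) by rewrite /U'; case: ifPn => [/hU[]//|_]; exact: openT.
have U'0 w : U' w !=set0 by rewrite /U'; case: ifPn => [/hU[]//|_].
have fU' w : ~~ P w -> U' w = setT.
  by rewrite /U' sP => /negbTE ->; rewrite andbF.
have dU' w w' : size w = N -> size w' = N -> P w -> P w' ->
    U' w `&` U' w' !=set0 -> w = w'.
  move=> sw sw' Pw Pw'; have ws : w \in s by rewrite sP sw eqxx.
  have ws' : w' \in s by rewrite sP sw' eqxx.
  by rewrite /U' ws ws'; exact: dU.
exists (@Condition N U' oU' U'0 fU' dU').
have U's w : size w = N -> P w -> w \in s by move=> sw Pw; rewrite sP sw eqxx.
split => //=.
- split => //= w sw; case: (boolP (P w)) => [Pw|nPw].
    have ws := U's _ sw Pw; rewrite /U' ws.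
    by have [_ _ cU _] := hU _ ws; apply: subset_trans cU _ => y [].
  rewrite cell_free//; apply: contra nPw => Pt.
  by rewrite -(cat_take_drop (level q) w); exact: P_cat.
- by split => // w sw Pw; rewrite /= /U' (U's _ sw Pw); have [] := hU _ (U's _ sw Pw).
- move=> w sw Pw; rewrite /= /U' (U's _ sw Pw) => y Uy.
  by have [_ _ cU _] := hU _ (U's _ sw Pw); have [] := cU _ (subset_closure Uy).
Qed.

Section limit.
Variable q : nat -> condition.
Hypothesis refq : forall k, refines (q k.+1) (q k).
Hypothesis smq : forall k, small k (q k).

Let refq_le j k : (j <= k)%N -> j = k \/ refines (q k) (q j).
Proof.
elim: k => [|k IHk]; first by rewrite leqn0 => /eqP ->; left.
rewrite leq_eqVlt => /predU1P[->|/IHk[->|h]]; [by left|right; exact: refq|right].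
exact: refines_trans h.
Qed.

Let level_le j k : (j <= k)%N -> (level (q j) <= level (q k))%N.
Proof. by move=> /refq_le[->//|[]]. Qed.

Let at_cell k (t : cantor_space) := cell (q k) (mkseq t (level (q k))).

Let at_cell_closure k t : closure (at_cell k.+1 t) `<=` at_cell k t.
Proof.
have := (refq k).2 (mkseq t (level (q k.+1))); rewrite size_mkseq => /(_ erefl).
by rewrite take_mkseq// level_le.
Qed.

Let at_cellS j k t : (j <= k)%N -> at_cell k t `<=` at_cell j t.
Proof.
elim: k => [|k IHk]; first by rewrite leqn0 => /eqP ->.
rewrite leq_eqVlt => /predU1P[->//|/IHk]; apply: subset_trans.
by apply: subset_trans (@at_cell_closure k t); exact: subset_closure.
Qed.

Let P_le j k (t : cantor_space) : (j <= k)%N ->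
  P (mkseq t (level (q j))) -> P (mkseq t (level (q k))).
Proof.
move=> jk Pt; rewrite -(cat_take_drop (level (q j)) (mkseq _ (level (q k)))).
by rewrite take_mkseq ?level_le//; exact: P_cat.
Qed.

(** A descending sequence of small conditions is a Cantor scheme. Its limit map is
    defined by completeness, and its value is forced wherever cells are present. *)
Lemma limit_exists : exists F : cantor_space -> X,
  forall k (t : cantor_space), cell (q k) (mkseq t (level (q k))) (F t).
Proof.
suff h (t : cantor_space) : exists x, forall k, at_cell k t x.
  by exists (fun t => sval (cid (h t))) => k t; exact: (svalP (cid (h t)) k).
have [[j Pj]|nP] := pselect (exists j, P (mkseq t (level (q j)))); last first.
  have [x _] := cell_neq0 (q 0) [::]; exists x => k; rewrite /at_cell cell_free//.
  by apply/negP => Pk; apply: nP; exists k.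
have [k|k|k|x hx] := scale_complete scX (S := fun k => at_cell (j + k) t).
- by rewrite /at_cell; exact: cell_neq0.
- by rewrite addnS; exact: at_cell_closure.
- apply: (scale_anti scX (leq_addl j k)); apply: (smq _).2; first by rewrite size_mkseq.
  by apply: P_le Pj; exact: leq_addr.
- exists x => k; apply: (at_cellS (leq_maxr j k)).
  by rewrite maxnE; exact: hx.
Qed.

Variable F : cantor_space -> X.
Hypothesis FP : forall k (t : cantor_space), cell (q k) (mkseq t (level (q k))) (F t).

Lemma limit_nbhs (t : cantor_space) O : (exists k, P (mkseq t (level (q k)))) ->
  open O -> O (F t) -> exists2 k, P (mkseq t (level (q k))) &
    cell (q k) (mkseq t (level (q k))) `<=` O.
Proof.
move=> [j Pj] oO Ot; have [k hk] := scale_nbhs scX oO Ot.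
exists (maxn j k); first by apply: P_le Pj; exact: leq_maxl.
apply: hk; last exact: FP.
apply: (scale_anti scX (leq_maxr j k)); apply: (smq _).2; first by rewrite size_mkseq.
by apply: P_le Pj; exact: leq_maxl.
Qed.

Lemma limit_continuous (t : cantor_space) : (exists k, P (mkseq t (level (q k)))) ->
  {for t, continuous F}.
Proof.
move=> Pt O; rewrite nbhsE => -[U [oU UFt] UO].
have [k _ kU] := limit_nbhs Pt oU UFt.
have : nbhs t (cylinder (level (q k)) t).
  by apply: open_nbhs_nbhs; split => //; exact: open_cylinder.
apply: filterS => t' /cylinderE tt'; apply/UO/kU; rewrite -tt'; exact: FP.
Qed.

Lemma limit_unique (t : cantor_space) x : (exists k, P (mkseq t (level (q k)))) ->
  (forall k, cell (q k) (mkseq t (level (q k))) x) -> x = F t.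
Proof.
move=> Pt hx; apply: contrapT => xF.
have [|k _ kO] := limit_nbhs Pt (closed_openC (@hausdorff_closed1 _ x hX)).
  by move=> /esym.
exact: kO (hx k) erefl.
Qed.

End limit.

End conditions.

(** * Conditions as boxes of continuous maps *)

Lemma closed_cylinder n s : closed (cylinder n s).
Proof.
elim: n => [|n IHn]; first by rewrite cylinder0; exact: closedT.
rewrite cylinderS; apply: closedI => //.
apply: closed_comp; last by rewrite -openC; exact: discrete_open.
by move=> t _; exact: (@proj_continuous nat (fun=> bool)).
Qed.

Lemma compact_cylinder n s : compact (cylinder n s).
Proof.
apply: (@subclosed_compact _ _ [set: cantor_space]) => //.
  exact: closed_cylinder.
exact: cantor_space_compact.
Qed.

Lemma locally_constant_continuous (X : topologicalType) (f : cantor_space -> X)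
    (t : cantor_space) n :
  (forall t', cylinder n t t' -> f t' = f t) -> {for t, continuous f}.
Proof.
move=> ft O Oft; have : nbhs t (cylinder n t).
  by apply: open_nbhs_nbhs; split => //; exact: open_cylinder.
by apply: filterS => t' /ft /= ->; exact: nbhs_singleton.
Qed.

Lemma cylinder_widen m n s : (m <= n)%N -> cylinder n s `<=` cylinder m s.
Proof. by move=> mn t h i im; apply: h; exact: leq_trans mn. Qed.

Lemma cantor_maps_continuous (X : topologicalType) (g : cantor_maps X) :
  continuous g.
Proof. exact: (@cts_fun _ _ g). Qed.

(** By compactness, finitely many constraints [g K `<=` O] are decided by the
    images of the cylinders of one level. *)
Lemma cantor_maps_nbhs (X : topologicalType) (O : set (cantor_maps X)) g :
  open O -> O g -> exists m (S : seq bool -> set X),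
    [/\ forall w, open (S w), forall t, S (mkseq t m) (g t) &
        forall g' : cantor_maps X, (forall t, S (mkseq t m) (g' t)) -> O g'].
Proof.
move=> [W oW <-] Wg.
pose E := [set mS : nat * (seq bool -> set X) |
  (forall w, open (mS.2 w)) /\ forall t, mS.2 (mkseq t mS.1) (g t)].
pose B (mS : nat * (seq bool -> set X)) : set (cantor_space -> X) :=
  [set g' | forall t, mS.2 (mkseq t mS.1) (g' t)].
have FF : Filter (filter_from E B).
  apply: filter_from_filter.
    by exists (0, fun=> setT); split => // w; exact: openT.
  move=> [m S] [m' S'] [/= oS gS] [/= oS' gS'].
  exists (maxn m m', fun w => S (take m w) `&` S' (take m' w)).
    split=> [w|t] /=; first exact: openI.
    by rewrite !take_mkseq ?leq_maxl ?leq_maxr.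
  move=> g' h; split=> t /=; have := h t => /=;
    by rewrite !take_mkseq ?leq_maxl ?leq_maxr// => -[].
suff /(_ W) : filter_from E B --> (g : {compact-open, cantor_space -> X}).
  have : nbhs (g : {compact-open, cantor_space -> X}) W.
    by apply: open_nbhs_nbhs; split.
  by move=> h /(_ h)[[m S] [oS gS] BO]; exists m, S; split => // g' /BO.
apply/compact_open_cvgP => K V cK oV gKV.
have : \forall m \near \oo, K `<=` [set t | cylinder m t `<=` g @^-1` V].
  move/compact_near_coveringP : cK; apply => t Kt.
  have gVt : nbhs t (g @^-1` V).
    apply: cantor_maps_continuous; apply: open_nbhs_nbhs; split => //; apply: gKV.
    by exists t.
  have [n nV] := nbhs_cylinder gVt.
  exists (cylinder n t, [set m | (n <= m)%N]) => /=.
    by split; [apply: open_nbhs_nbhs; split => //; exact: open_cylinder|exists n].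
  move=> [t' m] /= [tt' nm] z t'z; apply: nV => i ni.
  by rewrite t'z ?tt'// (leq_trans ni).
move=> [m _ /(_ _ (leqnn m)) /= hm].
exists (m, fun w => if `[< exists2 t, K t & mkseq t m = w >] then V else setT).
  split=> /= [w|t]; case: ifPn => //; first by move=> _; exact: openT.
  by move=> /asboolP[t' Kt' tt']; apply: (hm _ Kt'); exact/cylinderE/esym.
move=> g' hg' _ [t Kt <-]; have /= := hg' t; case: ifPn => // /asboolP[].
by exists t.
Qed.

Section boxes.
Variables (X : topologicalType) (sm : nat -> set X -> Prop).
Hypotheses (scX : complete_scale sm) (hX : hausdorff_space X).
Hypothesis noiso : forall x : X, ~ open [set x].
Variable P : pred (seq bool).
Hypothesis P_cat : forall u v, P u -> P (u ++ v).
Variable u : seq bool.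
Hypothesis Pu : P u.

(** The restriction of a condition to the subcube of sequences that begin with
    [u], itself a copy of the Cantor cube. *)
Definition box (q : condition X P) : set (cantor_maps X) :=
  [set g | forall t, cell q (mkseq (prepend u t) (level q)) (g t)].

Lemma prepend_cylinder n t t' : mkseq t n = mkseq t' n ->
  mkseq (prepend u t) n = mkseq (prepend u t') n.
Proof.
move=> /cylinderE tt'; apply/cylinderE => i ni; rewrite /prepend.
by case: ifP => // _; apply: tt'; apply: leq_ltn_trans ni; exact: leq_subr.
Qed.

Lemma open_box q : open (box q).
Proof.
rewrite openE => g hg; set n := level q.
pose t_ (v : n.-tuple bool) : cantor_space := nth false v.
have mt (v : n.-tuple bool) : mkseq (t_ v) n = v.
  by have := mkseq_nth false v; rewrite size_tuple.
pose C v := cell q (mkseq (prepend u (t_ v)) n).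
suff : nbhs g [set g' : cantor_maps X | forall v : n.-tuple bool,
    g' @` cylinder n (t_ v) `<=` C v].
  apply: filterS => g' h t; have sm' : size (mkseq t n) == n by rewrite size_mkseq.
  have /= := h (Tuple sm'); rewrite /C.
  rewrite (prepend_cylinder (t' := t)) ?mt//; apply; exists t => //.
  by apply/cylinderE; rewrite mt.
apply: (@filter_forall _ _ (fun (v : n.-tuple bool) (g' : cantor_maps X) =>
  g' @` cylinder n (t_ v) `<=` C v) (nbhs g)) => v.
apply: open_nbhs_nbhs; split.
  exists [set g' | g' @` cylinder n (t_ v) `<=` C v] => //.
  by apply: compact_open_open; [exact: compact_cylinder|exact: cell_open].
move=> _ [t /cylinderE tv <-]; rewrite /C -(prepend_cylinder tv); exact: hg.
Qed.

Lemma box_neq0 q : box q !=set0.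
Proof.
pose f (t : cantor_space) := sval (cid (cell_neq0 q (mkseq (prepend u t) (level q)))).
have cf : continuous f.
  move=> t; apply: (@locally_constant_continuous _ _ _ (level q)) => t' /cylinderE tt'.
  by rewrite /f (prepend_cylinder tt').
by exists (mkcts cf) => t; rewrite /= /mkcts /f; case: cid.
Qed.

Lemma refines_box p q : refines p q -> box p `<=` box q.
Proof.
move=> pq g gp t; rewrite -(take_mkseq _ pq.1).
by apply: (refines_cell pq) (gp t); rewrite size_mkseq.
Qed.

(** The constraint that an open set puts on maps lives on the cylinders of one level,
    and a deeper condition can obey it. *)
Lemma box_refinement q (O : set (cantor_maps X)) k : open O -> O `&` box q !=set0 ->
  exists p, [/\ refines p q, small sm k p & box p `<=` O].
Proof.
move=> oO [g [Og qg]]; have [m [S [oS gS SO]]] := cantor_maps_nbhs oO Og.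
pose N := maxn (maxn (level q) (m + size u)) k.
have qN : (level q <= N)%N by rewrite /N; lia.
have mN : (m + size u <= N)%N by rewrite /N; lia.
have kN : (k <= N)%N by rewrite /N; lia.
pose G w := if take (size u) w == u then S (take m (drop (size u) w)) else setT.
have GE t : G (mkseq (prepend u t) N) = S (mkseq t m).
  rewrite /G mkseq_prepend_long; last by lia.
  by rewrite take_size_cat// eqxx drop_size_cat// take_mkseq//; lia.
have [|p [pq pN smp pG]] := refinement scX hX noiso P_cat qN kN (G := G).
  move=> w sw Pw; rewrite /G; split.
    by case: ifPn => // _; exact: openT.
  case: ifPn => [/eqP wu|_]; last first.
    by have [x xq] := cell_neq0 q (take (level q) w); exists x.
  pose t : cantor_space := nth false (drop (size u) w).
  have tw : w = mkseq (prepend u t) N.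
    rewrite mkseq_prepend_long; last by lia.
    by rewrite -sw -size_drop mkseq_nth -{1}wu cat_take_drop.
  exists (g t); split; last by rewrite tw take_mkseq.
  suff -> : take m (drop (size u) w) = mkseq t m by [].
  by rewrite tw mkseq_prepend_long ?drop_size_cat ?take_mkseq//; lia.
exists p; split => // g' gp; apply: SO => t; rewrite -GE; apply: pG.
- by rewrite size_mkseq.
- by rewrite mkseq_prepend_long; [exact: P_cat|lia].
- by rewrite -pN; exact: gp.
Qed.

End boxes.

(** * Compact sets: the range map *)

Section vietoris.
Variable X : topologicalType.

Lemma open_vietoris_subbase (V : set (hyperspace X)) :
  vietoris_subbase V -> open V.
Proof.
move=> sV; exists [set V]; last by rewrite bigcup_set1.
move=> _ ->; exists (fset1 V) => //; last by rewrite set_fset1 bigcap_set1.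
by move=> W /fset1P ->; exact: mem_set.
Qed.

Lemma vietoris_nbhs (O : set (hyperspace X)) K : open O -> O K ->
  exists (A : set X) (L : nat) (B : nat -> set X),
  [/\ open A /\ (forall l, open (B l)), sval K `<=` A,
      forall l, (l < L)%N -> sval K `&` B l !=set0 &
      forall K' : hyperspace X, sval K' `<=` A ->
        (forall l, (l < L)%N -> sval K' `&` B l !=set0) -> O K'].
Proof.
move=> [D DI <-] [V DV VK]; have [s sub VE] := DI _ DV.
suff h (r : seq (set (hyperspace X))) :
    (forall W, W \in r -> vietoris_subbase W /\ W K) ->
    exists (A : set X) (L : nat) (B : nat -> set X),
    [/\ open A /\ (forall l, open (B l)), sval K `<=` A,
      forall l, (l < L)%N -> sval K `&` B l !=set0 &
      forall K' : hyperspace X, sval K' `<=` A ->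
        (forall l, (l < L)%N -> sval K' `&` B l !=set0) -> forall W, W \in r -> W K'].
  have [|A [L [B [oAB KA KB h']]]] := h (enum_fset s).
    move=> W Ws; split; first by exact: set_mem (sub _ Ws).
    by move: VK; rewrite -VE; apply.
  exists A, L, B; split => // K' K'A K'B; exists V => //; rewrite -VE.
  suff : (\bigcap_(W in [set` s]) W) K' by [].
  by move=> W Ws; apply: h'.
have [_ K0] := svalP K.
elim: r => [_|W r IHr hr].
  exists setT, 0, (fun=> setT); split => //; split; first exact: openT.
  by move=> _; exact: openT.
have [W' W'r|A [L [B [[oA oB] KA KB h]]]] := IHr.
  by apply: hr; rewrite inE W'r orbT.
have [[U oU [WE|WE]] WK] := hr W (mem_head _ _); rewrite WE/= in WK.
- exists (A `&` U), L, B; split => //.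
  + by split => //; exact: openI.
  + by move=> x Kx; split; [exact: KA|exact: WK].
  + move=> K' K'A K'B W'; rewrite inE => /predU1P[->|]; last first.
      by apply: h => // x /K'A[].
    by rewrite WE => x /K'A[].
- exists A, L.+1, (fun l => if l is m.+1 then B m else U); split => //.
  + by split => // -[].
  + by case => //= l; exact: KB.
  + move=> K' K'A K'B W'; rewrite inE => /predU1P[->|]; last first.
      by apply: h => // l lL; exact: (K'B l.+1).
    by rewrite WE; exact: (K'B 0).
Qed.

Definition range_compact (g : cantor_maps X) : hyperspace X.
Proof.
exists (range g); split; last by exists (g point), point.
apply: continuous_compact; last exact: cantor_space_compact.
by apply: continuous_subspaceT; exact: cantor_maps_continuous.
Defined.

End vietoris.

Section hyperspace.
Variables (X : topologicalType) (sm : nat -> set X -> Prop).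
Hypotheses (scX : complete_scale sm) (hX : hausdorff_space X).
Hypothesis noiso : forall x : X, ~ open [set x].
Let P : pred (seq bool) := predT.
Let P_cat u v : P u -> P (u ++ v). Proof. by []. Qed.

Definition vietoris_box (q : condition X P) : set (hyperspace X) :=
  [set K | sval K `<=` \bigcup_(w in [set w | size w = level q]) cell q w /\
    forall w, size w = level q -> sval K `&` cell q w !=set0].

Lemma open_vietoris_box q : open (vietoris_box q).
Proof.
rewrite openE => K [Ksub Kmeet]; set n := level q in Ksub Kmeet *.
suff : nbhs K [set K' : hyperspace X |
    sval K' `<=` \bigcup_(w in [set w | size w = n]) cell q w /\
    forall v : n.-tuple bool, sval K' `&` cell q v !=set0].
  apply: filterS => K' [K's K'm]; split => // w /eqP sw.
  exact: (K'm (Tuple sw)).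
apply: filterI.
  apply: open_nbhs_nbhs; split => //; apply: open_vietoris_subbase.
  eexists; last by left. by apply: bigcup_open => w _; exact: cell_open.
apply: (@filter_forall _ _ (fun (v : n.-tuple bool) (K' : hyperspace X) =>
  sval K' `&` cell q v !=set0) (nbhs K)) => v.
apply: open_nbhs_nbhs; split; last by apply: Kmeet; rewrite size_tuple.
by apply: open_vietoris_subbase; exists (cell q v); [exact: cell_open|right].
Qed.

Lemma box_vietoris_box q g : box [::] q g -> vietoris_box q (range_compact g).
Proof.
have prepend0 (t : cantor_space) n : mkseq (prepend [::] t) n = mkseq t n.
  by rewrite mkseq_prepend_long ?subn0.
move=> qg; split=> [_ [t _ <-]|w sw].
  exists (mkseq t (level q)); first by rewrite /= size_mkseq.
  by rewrite -(prepend0 t); exact: qg.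
pose t : cantor_space := nth false w; exists (g t); split; first by exists t.
by have := qg t; rewrite prepend0 -sw mkseq_nth.
Qed.

Lemma vietoris_box_neq0 q : vietoris_box q !=set0.
Proof.
by have [g /box_vietoris_box gq] := box_neq0 [::] q; exists (range_compact g).
Qed.

Lemma refines_vietoris_box p q : refines p q -> vietoris_box p `<=` vietoris_box q.
Proof.
move=> pq K [Ks Km]; split=> [x /Ks[w /= sw pw]|w sw].
  exists (take (level q) w); first by rewrite /= size_takel// sw pq.1.
  exact: (refines_cell pq) pw.
pose v := w ++ nseq (level p - level q) false.
have sv : size v = level p by rewrite size_cat size_nseq sw subnKC// pq.1.
have [x [Kx px]] := Km v sv; exists x; split => //.
by have := refines_cell pq sv px; rewrite -sw take_size_cat.
Qed.

(** Splitting a cell into sufficiently many pieces leaves room for a piece inside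
    each of the finitely many open sets that a member has to meet; the piece for
    the [l]-th of them is addressed by a word beginning with [l] ones. *)
Lemma vietoris_refinement q (O : set (hyperspace X)) : open O ->
  O `&` vietoris_box q !=set0 -> exists2 p, refines p q & vietoris_box p `<=` O.
Proof.
move=> oO [K [OK [Ks Km]]].
have [A [L [B [[oA oB] KA KB hO]]]] := vietoris_nbhs oO OK.
set n := level q in Ks Km.
pose hit w l := `[< sval K `&` cell q w `&` B l !=set0 >].
pose G w := A `&` (let l := index false (drop n w) in
  if hit (take n w) l then B l else setT).
have [|//||p [pq pN _ pG]] := @refinement _ _ scX hX noiso P P_cat q (n + L) 0 G.
- exact: leq_addr.
- move=> w sw _; rewrite /G /=; split.
    by apply: openI => //; case: ifPn => // _; exact: openT.
  case: ifPn => [/asboolP[x [[Kx qx] Bx]]|_].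
    by exists x; split => //; split => //; exact: KA.
  have [|x [Kx qx]] := Km (take n w); first by rewrite size_takel// sw leq_addr.
  by exists x; split => //; split => //; exact: KA.
exists p => // K' [K's K'm]; apply: hO => [x /K's[w /= sw /pG]|l lL].
  by rewrite -pN => /(_ sw isT)[].
have [z [Kz Bz]] := KB l lL; have [w /= sw qz] := Ks z Kz.
pose v := w ++ nseq l true ++ nseq (L - l) false.
have sv : size v = (n + L)%N by rewrite !size_cat !size_nseq sw subnKC// ltnW.
have [x [K'x px]] := K'm v (etrans sv (esym pN)).
exists x; split => //; have [_] := pG v sv isT x px.
rewrite take_size_cat// drop_size_cat//=.
have -> : index false (nseq l true ++ nseq (L - l) false) = l.
  rewrite index_cat mem_nseq andbF size_nseq -subnSK//= addn0 //.
suff -> : hit w l by [].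
by apply/asboolP; exists z.
Qed.

(** A compact set in all the boxes is the range of the limit map: at each level its
    points share cells with points of the range, and it meets every cell. *)
Lemma limit_range (q : nat -> condition X P) (F : cantor_space -> X) K :
  (forall k, refines (q k.+1) (q k)) -> (forall k, small sm k (q k)) ->
  (forall k (t : cantor_space), cell (q k) (mkseq t (level (q k))) (F t)) ->
  continuous F -> (forall k, vietoris_box (q k) K) -> sval K = range F.
Proof.
move=> refq smq FP cF Kq.
have cR : closed (range F).
  apply: compact_closed => //; apply: continuous_compact; last exact: cantor_space_compact.
  exact: continuous_subspaceT.
have cK : closed (sval K) by apply: compact_closed => //; exact: (svalP K).1.
apply/seteqP; split=> [z Kz|_ [t _ <-]].
  apply: cR => U; rewrite nbhsE => -[V [oV Vz] VU].
  have [k kV] := scale_nbhs scX oV Vz.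
  have [w /= sw qw] := (Kq k).1 z Kz.
  exists (F (nth false w)); split; first by exists (nth false w).
  apply/VU/(kV (cell (q k) w)) => //; first exact: (smq k).2.
  by have := FP k (nth false w); rewrite -sw mkseq_nth.
apply: cK => U; rewrite nbhsE => -[V [oV Vz] VU].
have [|k _ kV] := limit_nbhs scX P_cat refq smq FP _ oV Vz; first by exists 0.
have [|x [Kx qx]] := (Kq k).2 (mkseq t (level (q k))); first by rewrite size_mkseq.
by exists x; split => //; apply/VU/kV.
Qed.

(** Distinct sequences are separated by some level, whose cells are disjoint. *)
Lemma limit_injective (q : nat -> condition X P) (F : cantor_space -> X) :
  (forall k, small sm k (q k)) ->
  (forall k (t : cantor_space), cell (q k) (mkseq t (level (q k))) (F t)) ->
  injective F.
Proof.
move=> smq FP s t st; apply/funext => i.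
have /cylinderE : mkseq s (level (q i.+1)) = mkseq t (level (q i.+1)).
  apply: (@cell_disjoint _ _ (q i.+1)) => //; rewrite ?size_mkseq//.
  by exists (F s); split; [exact: FP|rewrite st; exact: FP].
by move=> /(_ i)->//; exact: (smq i.+1).1.
Qed.

End hyperspace.

Section hyperspace_transfer.
Variables (X : topologicalZmodType) (sm : nat -> set X -> Prop).
Hypotheses (scX : complete_scale sm) (hX : hausdorff_space X).
Hypothesis noiso : forall x : X, ~ open [set x].
Let P : pred (seq bool) := predT.
Let P_cat u v : P u -> P (u ++ v). Proof. by []. Qed.

Variables (A : set X) (I : set_system cantor_space).
Variable J : hyperspace X -> set X -> Prop.
Hypothesis IJ : forall (F : cantor_space -> X) (K : hyperspace X) (B : set X),
  continuous F -> injective F -> sval K = range F -> I (F @^-1` B) <-> J K B.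

Let top_cond : exists q : condition X P, level q = 0 /\ cell q = fun=> setT.
Proof. by apply: trivial_condition_exists; exists 0. Qed.

Let limit_map (q : nat -> condition X P) :
  (forall k, refines (q k.+1) (q k)) -> (forall k, small sm k (q k)) ->
  exists F : cantor_maps X,
    (forall k (t : cantor_space), cell (q k) (mkseq t (level (q k))) (F t)) /\
    forall k, box [::] (q k) F.
Proof.
move=> refq smq; have [F FP] := limit_exists scX P_cat refq smq.
have cF : continuous F.
  by move=> t; apply: (limit_continuous scX P_cat refq smq FP); exists 0.
exists (mkcts cF); split => // k t /=.
by rewrite mkseq_prepend_long// subn0; exact: FP.
Qed.

(** A condition is at once a box of continuous maps and a box of compact sets, and
    the refinement lemmas on both sides allow a descending sequence to enter the
    given dense open sets on one side while its boxes run through a comeager set of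
    points on the other side. The two points determined by such a sequence are an
    injective map and its range. *)
Lemma generically_Haar_hyperspace : generically_Haar A I <->
  comeager [set K : hyperspace X | forall x, J K (translate A x)].
Proof.
have [q0 [q00 q0T]] := top_cond.
have denseT : dense [set: cantor_maps X] by move=> O [g Og] _; exists g.
have small_box k (q : condition X P) D : open D -> dense D ->
    exists2 p, refines p q & small sm k p /\ box [::] p `<=` D.
  move=> oD dD; have [|p [pq sp pD]] := @box_refinement _ _ scX hX noiso P P_cat
    [::] isT q D k oD; last by exists p.
  by rewrite setIC; apply: dD; [exact: box_neq0|exact: open_box].
split=> [/comeager_bigcap_open[D oD DA]|/comeager_bigcap_open[D oD DA]].
- apply: comeagerS (comeager_descending (Q := condition X P)
    (le := @refines X P) (V := @vietoris_box X)
    (D := fun k => [set q | small sm k q /\ box [::] q `<=` D k]) (top := q0)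
    _ _ _ _ _ _ _).
  + move=> K [q hq].
    have refq k : refines (q k.+1) (q k) by have [] := hq k.
    have smq k : small sm k (q k) by have [_ []] := hq k.
    have [F [FP Fq]] := limit_map refq smq.
    have cF : continuous F by exact: cantor_maps_continuous.
    have KF : sval K = range F.
      by apply: (limit_range scX hX refq smq FP cF) => k; have [] := hq k.
    have injF := limit_injective smq FP.
    have /DA AF : (\bigcap_k D k) F by move=> k _; have [_ [_ qD] _] := hq k; exact: qD.
    by move=> x; apply/(IJ _ cF injF KF); exact: AF.
  + exact: refines_trans.
  + exact: open_vietoris_box.
  + exact: vietoris_box_neq0.
  + exact: refines_vietoris_box.
  + apply/seteqP; split => // K _; rewrite /vietoris_box /= q00 q0T.
    have [x Kx] := (svalP K).2.
    by split=> [y _|w _]; [exists [::]|exists x].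
  + by move=> q O oO Oq; exact: (vietoris_refinement scX hX noiso).
  + move=> k q; have [oDk dDk] := oD k; exact: small_box.
- apply: comeagerS (comeager_descending (Q := condition X P)
    (le := @refines X P) (V := @box X P [::])
    (D := fun k => [set q | small sm k q /\ vietoris_box q `<=` D k]) (top := q0)
    _ _ _ _ _ _ _).
  + move=> g [q hq].
    have refq k : refines (q k.+1) (q k) by have [] := hq k.
    have smq k : small sm k (q k) by have [_ []] := hq k.
    have gP k (t : cantor_space) : cell (q k) (mkseq t (level (q k))) (g t).
      have [_ _ /(_ t)] := hq k; rewrite mkseq_prepend_long// subn0; exact.
    have cg : continuous g by exact: cantor_maps_continuous.
    have injg := limit_injective smq gP.
    have /DA Ag : (\bigcap_k D k) (range_compact g).
      by move=> k _; have [_ [_ qD] /box_vietoris_box] := hq k; exact: qD.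
    by move=> x; apply/(IJ (K := range_compact g) _ cg injg) => //; exact: Ag.
  + exact: refines_trans.
  + exact: open_box.
  + exact: box_neq0.
  + exact: refines_box.
  + by apply/seteqP; split => // g _; rewrite /box /= q0T.
  + move=> q O oO Oq; have [p [pq _ pO]] :=
      @box_refinement _ _ scX hX noiso P P_cat [::] isT q O 0 oO Oq; by exists p.
  + move=> k q; have [oDk dDk] := oD k.
    have [|p pq pD] := @vietoris_refinement _ _ scX hX noiso q (D k) oDk.
      by rewrite setIC; apply: dDk; [exact: vietoris_box_neq0|exact: open_vietoris_box].
    have [r rp [sr _]] := small_box k p setT openT denseT.
    exists r; first exact: refines_trans rp pq.
    by split => //; apply: subset_trans pD; exact: refines_vietoris_box.
Qed.

End hyperspace_transfer.

Lemma card_range_setI (X : choiceType) (F : cantor_space -> X) (K B : set X) :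
  injective F -> K = range F -> (F @^-1` B #= K `&` B)%card.
Proof.
move=> injF ->; rewrite (_ : range F `&` B = F @` (F @^-1` B)).
  by rewrite card_eq_sym; apply: inj_card_eq => s t _ _; exact: injF.
by apply/seteqP; split=> [_ [[t _ <-] BFt]|_ [t BFt <-]]; [exists t|split => //; exists t].
Qed.

Lemma preimage_homeo_meager (S T : topologicalType) (h : S -> T) (g : T -> S)
    (B : set T) :
  continuous h -> continuous g -> cancel h g -> cancel g h ->
  meager B -> meager (h @^-1` B).
Proof.
move=> ch cg hK gK [N ndN BN]; exists (fun i => h @^-1` N i); last first.
  by move=> s /BN[i _ Nhs]; exists i.
move=> i; have := ndN i; rewrite /nowhere_dense -!subset0 => N0 s.
rewrite /interior nbhsE => -[U [oU Us] Ucl]; apply: (N0 (h s)).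
rewrite /interior nbhsE; exists (g @^-1` U).
  by split; [exact: open_comp|rewrite /= hK].
move=> z /Ucl clz V Vz; have : nbhs (g z) (h @^-1` V) by apply: ch; rewrite gK.
by move=> /clz[r []]; exists (h r).
Qed.

Lemma meager_range (X : topologicalType) (F : cantor_space -> X) (K B : set X) :
  hausdorff_space X -> continuous F -> injective F -> K = range F ->
  meager (F @^-1` B) <-> meager (set_val @^-1` B : set (set_type K)).
Proof.
move=> hX cF injF KF.
have FK t : F t \in K by rewrite KF; apply: mem_set; exists t.
pose h t : set_type K := SigSub (FK t).
have KF' (k : set_type K) : exists t, F t = set_val k.
  have [t _ Ftk] : range F (set_val k) by rewrite -KF; exact: set_mem (valP k).
  by exists t.
pose g k := sval (cid (KF' k)).
have Fg k : F (g k) = set_val k by rewrite /g; case: cid.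
have hK : cancel h g by move=> t; apply: injF; rewrite Fg.
have gK : cancel g h by move=> k; apply: val_inj; rewrite /= Fg.
have ch : continuous h.
  apply/continuousP => _ [U oU <-]; move/continuousP : cF; exact.
have cg : continuous g.
  apply/continuous_closedP => C cC.
  rewrite (_ : g @^-1` C = set_val @^-1` (F @` C)).
    apply: closed_comp => [k _|]; first exact: initial_continuous.
    apply: compact_closed => //; apply: continuous_compact.
      exact: continuous_subspaceT.
    by apply: (@subclosed_compact _ _ [set: cantor_space]) => //; exact: cantor_space_compact.
  apply/seteqP; split=> k /=; first by move=> Cgk; exists (g k).
  by move=> [t Ct Ftk]; suff -> : g k = t by []; apply: injF; rewrite Fg.
split=> mB.
  rewrite (_ : set_val @^-1` B = g @^-1` (F @^-1` B)).
    exact: (preimage_homeo_meager cg ch gK hK mB).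
  by apply/funext => k /=; rewrite Fg.
exact: (preimage_homeo_meager (h := h) (g := g) ch cg hK gK mB).
Qed.

Section hyperspace_equivalences.
Variables (R : realType) (X : topologicalZmodType) (A : set X).
Hypothesis polishX : polish R X.
Hypothesis nondiscreteX : ~ discrete_space X.

Lemma nondiscrete_no_isolated (x : X) : ~ open [set x].
Proof.
move=> ox; apply: nondiscreteX => B.
rewrite (_ : B = \bigcup_(b in B) [set b]); last first.
  by apply/seteqP; split=> [b Bb|_ [b Bb ->]//]; exists b.
apply: bigcup_open => b _.
rewrite (_ : [set b] = (fun y => y + (x - b)) @^-1` [set x]).
  apply: open_comp => // y _; set c := x - b.
  apply: (@continuous_comp _ _ _ (fun y => (y, c)) (fun z : X * X => z.1 + z.2)).
    by apply: cvg_pair; [exact: cvg_id|exact: cvg_cst].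
  exact: add_continuous.
apply/seteqP; split=> [_ ->|y /= /eqP]; first by rewrite /= addrC subrK.
by rewrite addrA -subr_eq0 addrAC addrK subr_eq0 => /eqP.
Qed.

(** In each case an injective continuous map on the Cantor cube carries the ideal of
    the cube to the corresponding ideal of its range. *)
Lemma generically_Haar_meager_compacts :
  generically_Haar_meager A <-> comeager (compacts_meager A).
Proof.
have [_ /completely_metrizable_scale[hX [sm scX]]] := polishX.
apply: (generically_Haar_hyperspace scX hX nondiscrete_no_isolated A
  (J := fun K B => meager (set_val @^-1` B : set (set_type (sval K))))).
by move=> F K B cF injF KF; exact: meager_range.
Qed.

Lemma generically_Haar_countable_compacts :
  generically_Haar_countable A <-> comeager (compacts_countable A).
Proof.
have [_ /completely_metrizable_scale[hX [sm scX]]] := polishX.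
apply: (generically_Haar_hyperspace scX hX nondiscrete_no_isolated A
  (J := fun K B => countable (sval K `&` B))).
by move=> F K B cF injF KF; rewrite /= (eq_countable (card_range_setI B injF KF)).
Qed.

Lemma generically_Haar_finite_compacts :
  generically_Haar_finite A <-> comeager (compacts_finite A).
Proof.
have [_ /completely_metrizable_scale[hX [sm scX]]] := polishX.
apply: (generically_Haar_hyperspace scX hX nondiscrete_no_isolated A
  (J := fun K B => finite_set (sval K `&` B))).
by move=> F K B cF injF KF; rewrite /= (eq_finite_set (card_range_setI B injF KF)).
Qed.

Lemma generically_Haar_n_compacts n :
  generically_Haar_n A n <-> comeager (compacts_le A n).
Proof.
have [_ /completely_metrizable_scale[hX [sm scX]]] := polishX.
apply: (generically_Haar_hyperspace scX hX nondiscrete_no_isolated A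
  (J := fun K B => (sval K `&` B #<= `I_n)%card)).
move=> F K B cF injF KF.
by rewrite /= (card_le_eql (card_range_setI B injF KF)).
Qed.

End hyperspace_equivalences.

(** * The coin measure *)

Lemma open_borel (T : ptopologicalType) (U : set (borel T)) :
  @open T U -> measurable U.
Proof. by move=> oU; apply: sub_sigma_algebra. Qed.

Lemma closed_borel (T : ptopologicalType) (C : set (borel T)) :
  @closed T C -> measurable C.
Proof.
move=> cC; rewrite -(setCK C); apply: measurableC; apply: open_borel.
exact: closed_openC.
Qed.

Lemma borel_measurable_fun d (S : measurableType d) (T : ptopologicalType)
    (F : S -> T) : (forall U : set T, open U -> measurable (F @^-1` U)) ->
  measurable_fun setT (F : S -> borel T).
Proof.
move=> mF; apply: (@measurability _ _ S (borel T) setT F (@open T)) => //.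
by move=> _ [U oU <-]; rewrite setTI; exact: mF.
Qed.

Lemma borel_preimage d (S : measurableType d) (T : ptopologicalType)
    (F : S -> T) (B : set (borel T)) :
  (forall U : set T, open U -> measurable (F @^-1` U)) ->
  measurable B -> measurable (F @^-1` B).
Proof.
by move=> /borel_measurable_fun mF mB; rewrite -[X in measurable X]setTI; exact: mF.
Qed.

Lemma pushforward_exists (R : realType) (T : ptopologicalType)
    (mu : probability (borel cantor_space) R) (F : cantor_space -> T) :
  (forall U : set T, open U -> measurable (F @^-1` U : set (borel cantor_space))) ->
  exists nu : probability (borel T) R, forall B, nu B = mu (F @^-1` B).
Proof.
move=> /(@borel_measurable_fun _ (borel cantor_space)) mF.
pose mfF : {mfun borel cantor_space >-> borel T} := mfun_Sub (mem_set mF).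
by exists (distribution mu mfF) => B; rewrite /distribution /pushforward.
Qed.

Section coin.
Variable R : realType.
Let coin := @coin_measure R.
Local Open Scope ereal_scope.

Lemma borel_cylinder n s : measurable (cylinder n s : set (borel cantor_space)).
Proof. by apply: open_borel; exact: open_cylinder. Qed.

Lemma coin_cylinder n s : coin (cylinder n s) = (2^-1 ^+ n)%:E.
Proof. exact: coin_measureP. Qed.

(** The coin measure is determined by its values on cylinders. *)
Lemma coin_preserving (F : cantor_space -> cantor_space) (B : set (borel cantor_space)) :
  continuous F -> (forall n s, coin (F @^-1` cylinder n s) = (2^-1 ^+ n)%:E) ->
  measurable B -> coin (F @^-1` B) = coin B.
Proof.
move=> cF hF mB.
have [|nu nuE] := @pushforward_exists R cantor_space coin F.
  by move=> U oU; apply: open_borel; exact: open_comp.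
rewrite -[LHS]nuE; apply: coin_measure_unique => //; last exact: coin_measureP.
by move=> n s; rewrite nuE; exact: hF.
Qed.

Definition shift n (t : cantor_space) : cantor_space := fun i => t (n + i)%N.
Definition flip (t : cantor_space) : cantor_space :=
  fun i => if i == 0%N then ~~ t 0%N else t i.

Lemma coordinatewise_continuous (F : cantor_space -> cantor_space) (m : nat) :
  (forall n t t', cylinder (m + n) t t' -> cylinder n (F t) (F t')) -> continuous F.
Proof.
move=> hF t O /nbhs_cylinder[n nO].
have : nbhs t (cylinder (m + n) t).
  by apply: open_nbhs_nbhs; split => //; exact: open_cylinder.
by apply: filterS => t' /hF /nO.
Qed.

Lemma shift_continuous n : continuous (shift n).
Proof.
apply: (@coordinatewise_continuous _ n) => k t t' tt' i ik.
by rewrite /shift tt'// ltn_add2l.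
Qed.

Lemma flip_continuous : continuous flip.
Proof.
apply: (@coordinatewise_continuous _ 0) => k t t' tt' i ik.
by rewrite /flip !tt'// (leq_ltn_trans _ ik).
Qed.

Lemma coin_flip (B : set (borel cantor_space)) :
  measurable B -> coin (flip @^-1` B) = coin B.
Proof.
apply: coin_preserving; first exact: flip_continuous.
move=> n s; rewrite (_ : _ @^-1` _ = cylinder n (flip s)); first exact: coin_cylinder.
apply/seteqP; split=> t h i ni; have := h i ni; rewrite /flip;
  case: eqVneq => [i0|//]; rewrite -?i0.
  by move=> <-; rewrite negbK.
by move=> ->; rewrite negbK.
Qed.

Lemma coin_shift n (B : set (borel cantor_space)) :
  measurable B -> coin (shift n @^-1` B) = coin B.
Proof.
have shift1 (B' : set (borel cantor_space)) : measurable B' -> coin (shift 1 @^-1` B') = coin B'.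
  apply: coin_preserving; first exact: shift_continuous.
  move=> k s; have sE b t : cylinder k.+1 (prepend [:: b] s) t <->
      t 0%N = b /\ cylinder k s (shift 1 t).
    split=> [h|[t0 h] [|i] ik]; first split.
    - by have := h 0%N; apply.
    - by move=> i ik; rewrite /shift h//= /prepend /= subn1.
    - by [].
    - by have := h i ik; rewrite /shift /prepend /= subn1.
  rewrite (_ : _ @^-1` _ = cylinder k.+1 (prepend [:: false] s) `|`
                           cylinder k.+1 (prepend [:: true] s)).
    rewrite measureU//; [|exact: borel_cylinder|exact: borel_cylinder|].
      rewrite [X in X + _]coin_cylinder [X in _ + X]coin_cylinder -EFinD; congr EFin.
      by rewrite exprS; lra.
    by rewrite -subset0 => t [/sE[t0 _] /sE[]]; rewrite t0.
  apply/seteqP; split=> [t h|t [/sE[]//|/sE[]//]].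
  case t0: (t 0%N).
    by right; apply/sE.
  by left; apply/sE.
elim: n B => [|n IHn] B mB; first by [].
rewrite -(IHn _ mB) -[RHS]shift1.
  by congr (coin _); apply/funext => t; rewrite /preimage/= /shift addSnnS.
apply: borel_preimage mB => U oU; apply: open_borel.
by apply: open_comp => // t _; exact: shift_continuous.
Qed.

End coin.

Section regularity.
Variables (R : realType) (mu : probability (borel cantor_space) R).
Local Open Scope ereal_scope.

Let increasing_gap (F : (set (borel cantor_space))^nat) (e : R) : (0 < e)%R ->
  (forall i, measurable (F i)) -> nondecreasing_seq F ->
  exists n, mu ((\bigcup_i F i) `\` F n) <= e%:E.
Proof.
move=> e0 mF ndF; pose G n := (\bigcup_i F i) `\` F n.
have mU : measurable (\bigcup_i F i) by exact: bigcupT_measurable.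
have mG n : measurable (G n) by exact: measurableD.
have G0 : \bigcap_n G n = set0.
  by rewrite -subset0 => t h; have [[i _ Fit] _] := h 0%N I; have [_] := h i I.
have : mu \o G @ \oo --> mu (\bigcap_n G n).
  apply: nonincreasing_cvg_mu => //; last 2 first.
  - by rewrite G0.
  - move=> m n mn; apply/subsetPset => t [Ut nFn]; split => // Fm.
    by apply: nFn; move/subsetPset : (ndF _ _ mn); apply.
  by apply: le_lt_trans (probability_le1 mu (mG 0%N)) _; rewrite ltry.
rewrite G0 measure0 => cv.
have : \forall n \near \oo, mu (G n) < e%:E.
  apply: (cv [set x | x < e%:E]); apply: open_nbhs_nbhs; split => /=.
    exact: open_ereal_lt_ereal.
  by rewrite lte_fin.
by move=> [n _ /(_ n (leqnn n)) h]; exists n; exact: ltW.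
Qed.

Let regular (B : set (borel cantor_space)) := forall e : R, (0 < e)%R ->
  exists C U : set cantor_space,
    [/\ closed C, open U, C `<=` B, B `<=` U & mu (U `\` C) <= e%:E].

Let regular_open (U : set cantor_space) : open U -> regular U.
Proof.
move=> oU e e0.
pose D j : set cantor_space := if @choice.unpickle (seq bool) j is Some w then
  if `[< cylinder (size w) (nth false w) `<=` U >] then
  cylinder (size w) (nth false w) else set0 else set0.
have cD j : closed (D j).
  rewrite /D; case: choice.unpickle => [w|]; last exact: closed0.
  by case: ifPn => _; [exact: closed_cylinder|exact: closed0].
have DU : U = \bigcup_j D j.
  rewrite {1}(open_bigcup_cylinder oU); apply/seteqP; split=> t.
    move=> [w /= wU tw]; exists (choice.pickle w) => //; rewrite /D choice.pickleK.
    by rewrite (asboolT wU).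
  move=> [j _]; rewrite /D; case: choice.unpickle => // w; case: ifPn => // /asboolP wU tw.
  by exists w.
pose F n : set (borel cantor_space) := \big[setU/set0]_(j < n) D j.
have cF n : closed (F n : set cantor_space) by apply: closed_bigsetU => j _.
have FD : \bigcup_n F n = \bigcup_j D j.
  apply/seteqP; split=> t [n _].
    by rewrite /F -bigcup_mkord => -[j _ Djt]; exists j.
  by move=> Dnt; exists n.+1 => //; rewrite /F -bigcup_mkord; exists n => //=.
have [||n hn] := increasing_gap (F := F) e0.
- by move=> i; exact: closed_borel.
- by apply/nondecreasing_seqP => n; apply/subsetPset; rewrite /F big_ord_recr; left.
exists (F n), U; split => //; last by rewrite DU -FD.
by move=> t Ft; rewrite DU -FD; exists n.
Qed.

Let regular_borel (B : set (borel cantor_space)) : measurable B -> regular B.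
Proof.
move=> mB; suff [] : (measurable `&` regular) B by [].
move: B mB; apply: smallest_sub; last first.
  by move=> U oU; split; [exact: open_borel|exact: regular_open].
split.
- split; first exact: measurable0.
  by apply: regular_open; exact: open0.
- move=> A [mA rA]; rewrite setTD; split; first exact: measurableC.
  move=> e /rA[C [U [cC oU CA AU Ue]]]; exists (~` U), (~` C); split.
  + exact: open_closedC.
  + exact: closed_openC.
  + exact: subsetC.
  + exact: subsetC.
  + by rewrite setDE setCK setIC -setDE.
- move=> A hA; split; first by apply: bigcupT_measurable => i; have [] := hA i.
  move=> e e0; pose d i : R := (e / 2 / (2 ^ i.+1)%:R)%R.
  have d0 i : (0 < d i)%R by rewrite divr_gt0 ?divr_gt0// ltr0n expn_gt0.
  have CU i : exists CU : set cantor_space * set cantor_space,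
      [/\ closed CU.1, open CU.2, CU.1 `<=` A i, A i `<=` CU.2 &
          mu (CU.2 `\` CU.1) <= (d i)%:E].
    by have [_ /(_ _ (d0 i))[C [U h]]] := hA i; exists (C, U).
  pose C i : set (borel cantor_space) := (sval (cid (CU i))).1.
  pose U i : set (borel cantor_space) := (sval (cid (CU i))).2.
  have P i : [/\ @closed cantor_space (C i), @open cantor_space (U i), C i `<=` A i, A i `<=` U i &
      mu (U i `\` C i) <= (d i)%:E] by rewrite /C /U; case: cid.
  have mC i : measurable (C i) by apply: closed_borel; have [] := P i.
  have mU i : measurable (U i) by apply: open_borel; have [] := P i.
  pose F n : set (borel cantor_space) := \big[setU/set0]_(j < n) C j.
  have FC : \bigcup_n F n = \bigcup_j C j.
    apply/seteqP; split=> t [n _].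
      by rewrite /F -bigcup_mkord => -[j _ Djt]; exists j.
    by move=> Dnt; exists n.+1 => //; rewrite /F -bigcup_mkord; exists n => //=.
  have mF n : measurable (F n) by apply: bigsetU_measurable.
  have e20 : (0 < e / 2)%R by rewrite divr_gt0.
  have [||n hn] := increasing_gap (F := F) e20 => //.
    by apply/nondecreasing_seqP => n; apply/subsetPset; rewrite /F big_ord_recr; left.
  exists (F n), (\bigcup_i U i); split.
  + by apply: closed_bigsetU => j _; have [] := P j.
  + by apply: bigcup_open => i _; have [] := P i.
  + rewrite /F -bigcup_mkord => t [i _ Cit]; exists i => //.
    by have [_ _ + _ _] := P i; apply.
  + by move=> t [i _ Ait]; exists i => //; have [_ _ _ + _] := P i; apply.
  + pose G i : set (borel cantor_space) := U i `\` C i.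
    have mG i : measurable (G i) by exact: measurableD.
    have mUG : measurable (\bigcup_i G i) by exact: bigcupT_measurable.
    have mFn : measurable ((\bigcup_i F i) `\` F n).
      by apply: measurableD => //; exact: bigcupT_measurable.
    have -> : (e = e / 2 + e / 2)%R by lra.
    have UGe : mu (\bigcup_i G i) <= (e / 2)%:E.
      apply: le_trans (epsilon_trick0 xpredT (ltW e20)).
      apply: le_trans (measure_sigma_subadditive mu mG mUG (@subset_refl _ _)) _.
      by apply: lee_nneseries => // i *; have [] := P i.
    rewrite EFinD; apply: le_trans (leeD UGe hn).
    apply: le_trans (measureU2 mu mUG mFn).
    have mUF : measurable ((\bigcup_i U i) `\` F n).
      by apply: measurableD => //; exact: bigcupT_measurable.
    have mGF := measurableU _ _ mUG mFn.
    apply: le_measure; [exact: mem_set mUF|exact: mem_set mGF|].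
    move=> t [[i _ Uit] nF]; have [Cit|nCit] := pselect (C i t).
      by right; split => //; rewrite FC; exists i.
    by left; exists i.
Qed.

(** The Borel sets squeezed between a closed and an open set of nearly the same
    measure form a sigma-algebra, which contains the open sets because these are
    countable unions of cylinders. *)
Lemma negligible_avoiding_closed (N : set (borel cantor_space)) (e : R) :
  measurable N -> mu N = 0 -> (0 < e)%R ->
  exists K : set cantor_space, [/\ closed K, K `&` N = set0 & (1 - e)%:E <= mu K].
Proof.
move=> mN N0 e0; have [C [U [cC oU CN NU Ue]]] := regular_borel mN e0.
exists (~` U); split; first exact: open_closedC.
  by rewrite -subset0 => t [nUt /NU].
have mU : measurable (U : set (borel cantor_space)) by exact: open_borel.
have mC : measurable (C : set (borel cantor_space)) by exact: closed_borel.
rewrite probability_setC// EFinB leeB//; apply: le_trans Ue.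
have C0 : mu C = 0.
  apply/eqP; rewrite eq_le measure_ge0 andbT -N0.
  by apply: le_measure => //; exact: mem_set.
rewrite measureD//; last by apply: le_lt_trans (probability_le1 mu mU) _; rewrite ltry.
rewrite setIidr; last exact: subset_trans NU.
by rewrite [X in _ - X]C0 sube0.
Qed.

End regularity.

(** * Measures: boxes in the space of probabilities *)

(** Rounding a probability vector down to multiples of [1 / #|T|] leaves some
    units over, which may go to any index of positive probability. *)
Lemma apportionment (R : realType) (S T : finType) (p : S -> R) :
  (forall s, 0 <= p s) -> \sum_s p s = 1 ->
  exists c : T -> S, (forall t, 0 < p (c t)) /\
    forall s, #|T|%:R * p s - 1 <= #|[pred t | c t == s]|%:R.
Proof.
move=> p0 p1; set M := #|T|.
have [s0 ps0] : exists s, 0 < p s.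
  apply: contrapT => h; suff : \sum_s p s = 0 by rewrite p1 => /eqP; rewrite oner_eq0.
  apply: big1 => s _; apply/eqP; rewrite eq_le p0 andbT leNgt.
  by apply/negP => ps; apply: h; exists s.
pose f s := Num.truncn (M%:R * p s).
have fP s : (f s)%:R <= M%:R * p s < (f s).+1%:R.
  by apply: truncn_itv; rewrite mulr_ge0 ?ler0n ?p0.
pose L := flatten [seq nseq (f s) s | s <- enum S].
have countL s : count_mem s L = f s.
  rewrite /L count_flatten -map_comp sumnE big_map big_enum /= (bigD1 s)//= big1 ?addn0.
    by rewrite count_nseq /= eqxx mul1n.
  by move=> s' /negbTE s's; rewrite count_nseq /= s's.
have sizeL : (size L <= M)%N.
  rewrite /L size_flatten /shape -map_comp sumnE big_map big_enum /=.
  under eq_bigr do rewrite size_nseq.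
  rewrite -(ler_nat R) natr_sum (_ : M%:R = \sum_s M%:R * p s); last first.
    by rewrite -mulr_sumr p1 mulr1.
  by apply: ler_sum => s _; have /andP[] := fP s.
pose L' := L ++ nseq (M - size L)%N s0.
pose c t := nth s0 L' (index t (enum T)).
have sizeL' : size L' = M by rewrite size_cat size_nseq; exact: subnKC sizeL.
have mapc : map c (enum T) = L'.
  apply: (@eq_from_nth _ s0) => [|i]; first by rewrite size_map -cardE.
  rewrite size_map => iT.
  have t : T by case: (enum T) iT.
  by rewrite (nth_map t)// /c index_uniq// enum_uniq.
exists c; split=> [t|s].
  have : c t \in L' by apply: mem_nth; rewrite sizeL' /M cardE index_mem mem_enum.
  rewrite mem_cat => /orP[|]; last by rewrite mem_nseq => /andP[_ /eqP ->].
  rewrite -has_pred1 has_count countL => ft.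
  have /andP[h _] := fP (c t); rewrite lt_neqAle p0 andbT eq_sym.
  apply/eqP => pc; move: h; rewrite pc mulr0 lern0 => /eqP ft0.
  by rewrite ft0 in ft.
have -> : #|[pred t | c t == s]| = count_mem s L'.
  rewrite -mapc count_map cardE -size_filter /enum_mem; congr size.
  by rewrite -filter_predI; apply: eq_filter => t; rewrite !inE andbT.
rewrite count_cat countL natrD -lerBlDr lerBlDr -lerBlDl.
have /andP[_] := fP s; rewrite -addn1 natrD => h.
have : 0 <= (count_mem s (nseq (M - size L)%N s0))%:R :> R by [].
lra.
Qed.

Lemma measure_seqU d (T : measurableType d) (R : realType)
    (mu : {measure set T -> \bar R}) (J : choiceType) (s : seq J) (F : J -> set T) :
  uniq s -> (forall j, j \in s -> measurable (F j)) ->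
  (forall i j, i \in s -> j \in s -> F i `&` F j !=set0 -> i = j) ->
  mu (\bigcup_(j in [set` s]) F j) = (\sum_(j <- s) mu (F j))%E.
Proof.
elim: s => [|j s IHs] /=; first by rewrite bigcup_seq !big_nil measure0.
move=> /andP[js us] mF dF; rewrite bigcup_seq !big_cons -bigcup_seq measureU.
- congr (_ + _)%E; apply: IHs => // [i si|i i' si si'].
    by apply: mF; rewrite inE si orbT.
  by apply: dF; rewrite inE ?si ?si' orbT.
- by apply: mF; rewrite mem_head.
- apply: fin_bigcup_measurable => [|i si]; first exact: finite_seq.
  by apply: mF; rewrite inE si orbT.
- rewrite -subset0 => x [Fj [i /= si Fi]].
  have ji : j = i.
    by apply: dF; rewrite ?mem_head// ?inE ?si ?orbT//; exists x.
  by move: js; rewrite ji si.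
Qed.

Lemma tuple_no_one n (w : n.-tuple bool) :
  ~~ has id w -> w = nseq_tuple n false.
Proof.
move=> /hasPn h; apply/val_inj => /=.
have /all_pred1P : all (pred1 false) w by apply/allP => b /h; case: b.
by rewrite size_tuple.
Qed.

(** Approximation of a probability by empirical measures adapted to a partition.
    The mass in [C w] beyond [2^-n], together with the mass outside all [C w],
    is handed to the single word [0^n]; each of the [2^n] words then carries a
    probability vector on the finite algebra generated by the [U l], to which
    apportionment applies. *)
Lemma allocation d (T : measurableType d) (R : realType) (mu : probability T R)
    (n L : nat) (C : n.-tuple bool -> set T) (U : 'I_L -> set T) (e : R) :
  (forall w, measurable (C w)) -> (forall l, measurable (U l)) ->
  (forall v w : n.-tuple bool, has id v -> has id w -> C v `&` C w !=set0 -> v = w) ->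
  (forall w : n.-tuple bool, has id w -> ((2^-1 ^+ n)%:E < mu (C w))%E) -> 0 < e ->
  exists (k : nat) (c : n.-tuple bool -> k.-tuple bool -> {ffun 'I_L -> bool}),
  [/\ forall (w : n.-tuple bool) v, exists x, (has id w -> C w x) /\ forall l, c w v l -> U l x &
      forall l, (mu (U l) <= (2^-1 ^+ (n + k) *
        #|[pred wv : n.-tuple bool * k.-tuple bool |
           has id (wv.1 ++ wv.2) && (c wv.1 wv.2 l)]|%:R + e)%:E)%E].
Proof.
move=> mC mU dC C_gt e0.
pose m B := fine (mu B).
have mE B : measurable B -> mu B = (m B)%:E.
  by move=> mB; rewrite /m fineK// fin_num_measure.
have m_ge0 B : 0 <= m B by rewrite /m fine_ge0.
pose phi x : {ffun 'I_L -> bool} := [ffun l => `[< U l x >]].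
pose E s := phi @^-1` [set s].
have mEs s : measurable (E s).
  rewrite (_ : E s = \bigcap_(l in [set: 'I_L]) (if s l then U l else ~` U l)).
    apply: fin_bigcap_measurable => // l _; case: ifPn => _ //.
    exact: measurableC.
  apply/seteqP; split=> [x <- l _|x h].
    by rewrite /phi ffunE; case: asboolP.
  apply/ffunP => l; rewrite /phi ffunE; have := h l I.
  by case: ifPn => ls Ul; [exact: asboolT|exact: asboolF].
have sumE B : measurable B -> \sum_s m (B `&` E s) = m B.
  move=> mB; apply: EFin_inj; rewrite -mE// -sumEFin.
  have {2}-> : B = \bigcup_(s in [set` enum {ffun 'I_L -> bool}]) (B `&` E s).
    apply/seteqP; split=> [x Bx|x [s _ []]] //.
    by exists (phi x) => //=; rewrite mem_enum.
  rewrite measure_seqU ?enum_uniq//.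
  - by rewrite big_enum; apply: eq_bigr => s _; rewrite -mE//; exact: measurableI.
  - by move=> s _; exact: measurableI.
  - by move=> s s' _ _ [x [[_ <-] [_ <-]]].
have sumC s : \sum_(w | has id (w : n.-tuple bool)) m (C w `&` E s) <= m (E s).
  rewrite -lee_fin -sumEFin -(mE (E s))//.
  pose ws := [seq w <- index_enum (n.-tuple bool) | has id (tval w)].
  have -> : (\sum_(w | has id (w : n.-tuple bool)) (m (C w `&` E s))%:E)%E =
      mu (\bigcup_(w in [set` ws]) (C w `&` E s)).
    rewrite measure_seqU ?filter_uniq ?index_enum_uniq//.
    - by rewrite big_filter; apply: eq_bigr => w _; rewrite -mE//; exact: measurableI.
    - by move=> w _; exact: measurableI.
    - move=> v w; rewrite !mem_filter => /andP[hv _] /andP[hw _] [x [[Cv _] [Cw _]]].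
      by apply: dC => //; exists x.
  apply: le_measure; last by move=> x [w _ []].
    apply: mem_set; apply: fin_bigcup_measurable => [|w _]; first exact: finite_seq.
    exact: measurableI.
  exact: mem_set.
pose z : n.-tuple bool := nseq_tuple n false.
have zP (w : n.-tuple bool) : has id w = (w != z).
  apply/idP/idP => [|wz]; first by apply: contraTN => /eqP ->; rewrite /= has_nseq andbF.
  by apply: contraR wz => /tuple_no_one ->.
pose a (w : n.-tuple bool) s := m (C w `&` E s) / m (C w).
pose r : R := 2^-1 ^+ n.
have r0 : 0 < r by rewrite exprn_gt0// invr_gt0.
have rE : r^-1 = 2 ^+ n by rewrite /r exprVn invrK.
have Cr w : has id (w : n.-tuple bool) -> r < m (C w).
  by move=> /C_gt; rewrite mE// lte_fin.
have sum1 w : has id (w : n.-tuple bool) -> \sum_s a w s = 1.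
  move=> wz; rewrite -mulr_suml sumE// divff//.
  by apply: lt0r_neq0; apply: lt_trans (Cr _ wz).
pose p w s := if has id (w : n.-tuple bool) then a w s
  else r^-1 * (m (E s) - \sum_(v | has id (v : n.-tuple bool)) r * a v s).
have mT : \sum_s m (E s) = 1.
  have := sumE setT measurableT; under eq_bigr do rewrite setTI.
  by move=> ->; rewrite /m probability_setT.
have cardz : \sum_(v | has id (v : n.-tuple bool)) r = 1 - r.
  have : \sum_(v : n.-tuple bool) r = 1.
    rewrite sumr_const card_tuple card_bool -mulr_natl natrX -rE mulVf//.
    exact: lt0r_neq0.
  rewrite (bigD1 z)//= => <-; rewrite addrAC subrr add0r.
  by apply: eq_bigl => v; rewrite zP.
have p_ge0 w s : 0 <= p w s.
  rewrite /p; case: ifPn => wz; first by rewrite divr_ge0.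
  rewrite mulr_ge0 ?invr_ge0 ?(ltW r0)// subr_ge0.
  apply: le_trans (sumC s); apply: ler_sum => v vz.
  rewrite /a mulrCA -[leRHS]mulr1 ler_wpM2l// ler_pdivrMr ?mul1r.
    exact: ltW (Cr _ vz).
  exact: lt_trans (Cr _ vz).
have p_sum w : \sum_s p w s = 1.
  rewrite /p; case: (boolP (has id w)) => wz; first exact: sum1.
  transitivity (r^-1 * \sum_s (m (E s) -
      \sum_(v | has id (v : n.-tuple bool)) r * a v s)); first by rewrite mulr_sumr.
  rewrite sumrB mT exchange_big /=.
  rewrite (eq_bigr (fun=> r)); last by move=> v vz; rewrite -mulr_sumr sum1// mulr1.
  by rewrite cardz opprB addrC subrK mulVf// lt0r_neq0.
have sump s : \sum_w p w s = r^-1 * m (E s).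
  rewrite (bigD1 z)//= {1}/p zP eqxx/= mulrBr mulr_sumr.
  rewrite (eq_bigr (a^~ s)); last first.
    by move=> v _; rewrite mulrA mulVf ?mul1r// lt0r_neq0.
  rewrite [X in _ + X](eq_bigr (a^~ s)); last by move=> v vz; rewrite /p zP vz.
  by rewrite (eq_bigl (fun v => v != z)) ?subrK// => v; rewrite zP.
have [k ke] : exists k, (2^-1 ^+ k) * (#|{ffun 'I_L -> bool}|%:R + 1) <= e.
  set N := _ + 1; have N0 : 0 < N by rewrite ltr_wpDl.
  exists (Num.truncn (N / e)).+1; rewrite exprVn mulrC ler_pdivrMr ?exprn_gt0//.
  rewrite mulrC -ler_pdivrMr//; apply/ltW/(lt_trans (truncnS_gt _)).
  by rewrite -natrX ltr_nat; exact: ltn_expl.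
pose T2 := k.-tuple bool.
have cardT2 : #|{: T2}|%:R = 2 ^+ k :> R by rewrite card_tuple card_bool natrX.
have hc w := @apportionment R _ T2 (p w) (p_ge0 w) (p_sum w).
pose c w := sval (cid (hc w)).
have c0 w v : 0 < p w (c w v) by rewrite /c; case: cid => ? [].
have cE w s : 2 ^+ k * p w s - 1 <= #|[pred v | c w v == s]|%:R.
  by rewrite -cardT2 /c; case: cid => ? [].
exists k, c; split=> [w v|l].
  have := c0 w v; set s := c w v; rewrite /p; case: ifPn => wz ps.
    have [x [Cx xs]] : C w `&` E s !=set0.
      apply/set0P/eqP => C0; move: ps; rewrite /a C0 /m measure0 /= mul0r.
      by rewrite ltxx.
    exists x; split => // l; rewrite -xs /phi ffunE.
    by move/asboolP.
  have [x xs] : E s !=set0.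
    apply/set0P/eqP => E0; move: ps; rewrite E0 {1}/m measure0 /= sub0r mulrN oppr_gt0.
    rewrite ltNge mulr_ge0// ?invr_ge0 ?(ltW r0)//.
    by apply: sumr_ge0 => v' _; rewrite mulr_ge0 ?(ltW r0)// divr_ge0.
  exists x; split => // l; rewrite -xs /phi ffunE.
  by move/asboolP.
rewrite mE// lee_fin; set D := #|_|.
pose D1 := #|[pred wv : n.-tuple bool * T2 | c wv.1 wv.2 l]|.
have D1D : (D1 <= D + 1)%N.
  rewrite /D1 -(cardID [pred wv : n.-tuple bool * T2 | has id (wv.1 ++ wv.2)]).
  apply: leq_add.
    by apply/eq_leq/eq_card => wv; rewrite !inE andbC.
  apply/card_le1_eqP => -[w v] [w' v'].
  rewrite !inE /= !has_cat !negb_or => /andP[/andP[/tuple_no_one -> /tuple_no_one ->] _].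
  by move=> /andP[/andP[/tuple_no_one -> /tuple_no_one ->] _].
have mUE : m (U l) = \sum_(s : {ffun 'I_L -> bool} | s l) m (E s).
  rewrite -(sumE _ (mU l)) [RHS]big_mkcond /=; apply: eq_bigr => s _.
  case: ifPn => sl.
    congr (m _); apply/setIidPr => x xs; apply/asboolP.
    by move: sl; rewrite -xs ffunE.
  rewrite (_ : _ `&` _ = set0); first by rewrite /m measure0.
  rewrite -subset0 => x [Ux xs]; move: sl; rewrite -xs ffunE.
  by move/negP; apply; exact/asboolP.
have D1E : D1 = (\sum_w \sum_(s : {ffun 'I_L -> bool} | s l) #|[pred v | c w v == s]|)%N.
  rewrite /D1 -sum1_card.
  transitivity (\sum_w \sum_(v | c w v l) 1)%N; first by rewrite pair_big_dep.
  apply: eq_bigr => w _; rewrite (partition_big (c w) (fun s => s l))//=.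
  apply: eq_bigr => s sl; rewrite -sum1_card; apply: eq_bigl => v.
  by rewrite inE; case: eqP => [->|_]; rewrite ?sl ?andbF.
have D1_ge : 2 ^+ k * (r^-1 * m (U l)) <= D1%:R + r^-1 * #|{ffun 'I_L -> bool}|%:R.
  rewrite mUE !mulr_sumr.
  under eq_bigr do rewrite -sump mulr_sumr.
  rewrite exchange_big /= D1E natr_sum rE.
  have -> : 2 ^+ n * #|{ffun 'I_L -> bool}|%:R =
      \sum_(w : n.-tuple bool) #|{ffun 'I_L -> bool}|%:R :> R.
    by rewrite sumr_const card_tuple card_bool -natrX mulr_natl.
  rewrite -big_split /=; apply: ler_sum => w _; rewrite natr_sum.
  rewrite -sum1_card natr_sum [X in _ + X](bigID (fun s : {ffun 'I_L -> bool} => s l)) /=.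
  rewrite addrA -big_split /= -[leLHS]addr0; apply: lerD; last by apply: sumr_ge0.
  by apply: ler_sum => s sl; rewrite -lerBlDr.
have r1 : r <= 1 by rewrite exprn_ile1 ?invr_ge0// invf_le1// ler1n.
have D1D' : D1%:R <= D%:R + 1 :> R by rewrite -[X in _ + X]/(1%:R) -natrD ler_nat.
have k0 : 0 < 2^-1 ^+ k :> R by rewrite exprn_gt0// invr_gt0.
have kk : 2^-1 ^+ k * 2 ^+ k = 1 :> R by rewrite -exprMn mulVf ?expr1n.
rewrite exprD -/r.
have rr : r * r^-1 = 1 by rewrite mulfV// lt0r_neq0.
set K := 2^-1 ^+ k in k0 kk ke *; set K' := 2 ^+ k in kk D1_ge; set r' := r^-1 in rr D1_ge.
set M := m (U l) in D1_ge *; set S := #|_|%:R in ke D1_ge.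
have : (r * K) * (K' * (r' * M)) <= (r * K) * (D%:R + 1 + r' * S).
  by rewrite ler_pM2l ?mulr_gt0//; lra.
have -> : (r * K) * (K' * (r' * M)) = (K * K') * (r * r') * M by ring.
have -> : (r * K) * (D%:R + 1 + r' * S) = r * K * D%:R + r * K + (r * r') * (K * S) by ring.
rewrite kk rr !mul1r => h; apply: le_trans h _.
have rK : r * K <= K by rewrite ler_piMl// ltW.
by rewrite -addrA lerD2l; apply: le_trans ke; rewrite mulrDr mulr1 addrC; lra.
Qed.

Lemma halves_split (R : realType) n d :
  2^-1 ^+ (n + d) *+ (2 ^ d)%N = 2^-1 ^+ n :> R.
Proof.
rewrite exprD -mulrnAr -(mulr_natr (2^-1 ^+ d)) natrX -exprMn mulVf//.
by rewrite expr1n mulr1.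
Qed.

Section prob_topology.
Variables (R : realType) (X : topologicalZmodType).

Lemma open_prob_subbase (V : set (prob_space R X)) : prob_subbase V -> open V.
Proof.
move=> sV; exists [set V]; last by rewrite bigcup_set1.
move=> _ ->; exists (fset1 V) => //; last by rewrite set_fset1 bigcap_set1.
by move=> W /fset1P ->; exact: mem_set.
Qed.

Lemma prob_nbhs (O : set (prob_space R X)) mu : open O -> O mu ->
  exists (L : nat) (U : 'I_L -> set X) (a : 'I_L -> R),
  [/\ forall l, open (U l), forall l, ((a l)%:E < mu (U l))%E &
      forall nu : prob_space R X, (forall l, ((a l)%:E < nu (U l))%E) -> O nu].
Proof.
move=> [D DI <-] [V DV Vmu]; have [s sub VE] := DI _ DV.
have hs W : W \in s -> exists Ua : set X * R, open Ua.1 /\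
    W = [set nu : prob_space R X | (Ua.2%:E < nu Ua.1)%E].
  by move=> /sub/set_mem[U [b [oU _ ->]]]; exists (U, b).
have hl (l : 'I_(size (enum_fset s))) : exists Ua : set X * R, open Ua.1 /\
    nth setT (enum_fset s) l = [set nu : prob_space R X | (Ua.2%:E < nu Ua.1)%E].
  by apply: hs; exact: mem_nth.
exists (size (enum_fset s)), (fun l => (sval (cid (hl l))).1),
  (fun l => (sval (cid (hl l))).2); split => [l|l|nu hnu].
- by case: cid => ? [].
- case: cid => Ua /= [_ UaE].
  suff : (nth setT (enum_fset s) l) mu by rewrite UaE.
  have : (\bigcap_(W in [set` s]) W) mu by move: Vmu; rewrite -VE.
  by apply; exact: mem_nth.
- exists V => //; rewrite -VE.
  suff : (\bigcap_(W in [set` s]) W) nu by [].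
  move=> W /= Ws; have lt : (index W (enum_fset s) < size (enum_fset s))%N.
    by rewrite index_mem.
  have := hnu (Ordinal lt); case: cid => Ua /= [_].
  by rewrite nth_index// => ->.
Qed.

End prob_topology.

Lemma open_fin_bigcap (X : topologicalType) (I : finType) (D : pred I)
    (U : I -> set X) : (forall i, open (U i)) ->
  open [set x | forall i, D i -> U i x].
Proof.
move=> oU; rewrite openE => x hx.
apply: (@filter_forall _ _ (fun i y => D i -> U i y) (nbhs x)) => i.
case: (boolP (D i)) => [Di|_]; last exact: nearW.
by apply: filterS (open_nbhs_nbhs (conj (oU i) (hx i Di))).
Qed.

Section measures.
Variables (R : realType) (X : topologicalZmodType).
Let P : pred (seq bool) := has id.
Let P_cat u v : P u -> P (u ++ v). Proof. by rewrite /P has_cat => ->. Qed.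
Local Open Scope ereal_scope.

Definition measure_box (q : condition X P) : set (prob_space R X) :=
  [set mu | forall w, size w = level q -> P w ->
    (2^-1 ^+ level q)%:E < mu (cell q w)].

(** The measure obtained from a limit map gives each cell at least the mass of its
    cylinder, and possibly no more: it lies in the closed boxes only. *)
Definition closed_measure_box (q : condition X P) : set (prob_space R X) :=
  [set mu | forall w, size w = level q -> P w ->
    (2^-1 ^+ level q)%:E <= mu (cell q w)].

Lemma borel_cell (q : condition X P) w :
  measurable (cell q w : set (borel (pointed_group X))).
Proof. by apply: open_borel; exact: cell_open. Qed.

Lemma open_measure_box q : open (measure_box q).
Proof.
pose n := level q.
rewrite (_ : measure_box q = [set mu : prob_space R X | forall w : n.-tuple bool,
    P w -> [set mu : prob_space R X | (2^-1 ^+ n)%:E < mu (cell q w)] mu]).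
  case: (posnP n) => [n0|n0].
    rewrite (_ : [set _ | _] = setT); first exact: openT.
    apply/seteqP; split => // mu _ w /=; have := size_tuple w.
    by case: (tval w) => //=; rewrite n0.
  apply: (@open_fin_bigcap _ (n.-tuple bool) P
    (fun w => [set mu : prob_space R X | (2^-1 ^+ n)%:E < mu (cell q w)])) => w.
  apply: open_prob_subbase; exists (cell q w), (2^-1 ^+ n)%R; split => //.
    exact: cell_open.
  by rewrite exprn_ge0 ?invr_ge0//= exprn_ilt1 ?invr_ge0 ?invf_lt1 ?ltr1n// -lt0n.
apply/seteqP; split => [mu h w Pw|mu h w /eqP sw Pw].
  by apply: h; rewrite ?size_tuple.
exact: (h (Tuple sw)).
Qed.

Lemma refines_prefixes (p q : condition X P) (mu : prob_space R X) w : refines p q ->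
  size w = level q -> P w ->
  \sum_(v : (level p - level q).-tuple bool) mu (cell p (w ++ v)) <= mu (cell q w).
Proof.
move=> pq sw Pw; have swv (v : (level p - level q).-tuple bool) :
    size (w ++ v) = level p by rewrite size_cat sw size_tuple subnKC// pq.1.
rewrite -(measure_seqU mu (F := fun v : (level p - level q).-tuple bool =>
  (cell p (w ++ v) : set (borel (pointed_group X))))).
- apply: le_measure.
  + apply: mem_set; apply: fin_bigcup_measurable => [|v _]; first exact: finite_seq.
    exact: borel_cell.
  + by apply: mem_set; exact: borel_cell.
  + move=> x [v _ /(refines_cell pq (swv v))].
    by rewrite take_size_cat.
- exact: index_enum_uniq.
- by move=> v _; exact: borel_cell.
- move=> v v' _ _ h; apply: val_inj; apply/eqP.
  have := @cell_disjoint _ _ p (w ++ v) (w ++ v') (swv v) (swv v') _ _ h.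
  move=> /(_ (P_cat _ Pw) (P_cat _ Pw)) /eqP; rewrite eqseq_cat// => /andP[_].
  exact.
Qed.

Let halves_sum (m n : nat) : (n <= m)%N ->
  (2^-1 ^+ n)%:E = \sum_(v : (m - n).-tuple bool) (2^-1 ^+ m)%:E :> \bar R.
Proof.
move=> nm; rewrite sumEFin sumr_const card_tuple card_bool.
by rewrite -{1}(subnKC nm) halves_split.
Qed.

Let size_extension (p q : condition X P) (w : seq bool)
    (v : (level p - level q).-tuple bool) :
  refines p q -> size w = level q -> size (w ++ v) = level p.
Proof. by move=> pq sw; rewrite size_cat sw size_tuple subnKC// pq.1. Qed.

Lemma refines_measure_box p q : refines p q -> measure_box p `<=` measure_box q.
Proof.
move=> pq mu hmu w sw Pw; apply: lt_le_trans (refines_prefixes _ pq sw Pw).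
rewrite (halves_sum pq.1); set z := nseq_tuple (level p - level q) false.
rewrite (bigD1 z)//= [X in _ < X](bigD1 z)//=; apply: lte_leD.
- by rewrite sumEFin.
- by apply: hmu; [exact: (size_extension z pq sw)|exact: P_cat].
- by apply: lee_sum => v _; apply/ltW/hmu; [exact: size_extension|exact: P_cat].
Qed.

Lemma refines_closed_measure_box p q : refines p q ->
  closed_measure_box p `<=` closed_measure_box q.
Proof.
move=> pq mu hmu w sw Pw; apply: le_trans (refines_prefixes _ pq sw Pw).
rewrite (halves_sum pq.1); apply: lee_sum => v _.
by apply: hmu; [exact: size_extension|exact: P_cat].
Qed.

End measures.

Section measure_refinement.
Variables (R : realType) (X : topologicalZmodType) (sm : nat -> set X -> Prop).
Hypotheses (scX : complete_scale sm) (hX : hausdorff_space X).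
Hypothesis noiso : forall x : X, ~ open [set x].
Let P : pred (seq bool) := has id.
Let P_cat u v : P u -> P (u ++ v). Proof. by rewrite /P has_cat => ->. Qed.
Let coin := @coin_measure R.
Local Open Scope ereal_scope.

(** The cylinder of a word [w] has mass exactly [2^-n], so the cells need a little
    more: the cylinder of [0^n] is split evenly among all the words. *)
Lemma measure_box_neq0 (q : condition X P) : @measure_box R X q !=set0.
Proof.
set n := level q; pose e w := sval (cid (cell_neq0 q w)).
have eP w : cell q w (e w) by rewrite /e; case: cid.
pose h (t : cantor_space) : pointed_group X :=
  if P (mkseq t n) then e (mkseq t n) else e (mkseq (shift n t) n).
have ch : continuous h.
  move=> t; apply: (@locally_constant_continuous _ _ _ (n + n)) => t' tt'.
  have -> : h t' = h t; last by [].
  rewrite /h; have -> : mkseq t' n = mkseq t n.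
    by apply/cylinderE; apply: cylinder_widen tt'; exact: leq_addr.
  have -> // : mkseq (shift n t') n = mkseq (shift n t) n.
  by apply/cylinderE => i ni; rewrite /shift tt'// ltn_add2l.
have [|nu nuE] := @pushforward_exists R (pointed_group X) coin h.
  by move=> U oU; apply: open_borel; exact: open_comp.
exists nu => w sw Pw; rewrite nuE -/n.
pose A1 : set (borel cantor_space) := cylinder n (nth false w).
pose A2 : set (borel cantor_space) := cylinder (n + n) (nth false (nseq n false ++ w)).
have mw : mkseq (nth false w) n = w by rewrite /n -sw mkseq_nth.
have A2E t : A2 t -> mkseq t n = nseq n false /\ mkseq (shift n t) n = w.
  move=> At; split; apply: (@eq_from_nth _ false); rewrite ?size_mkseq ?size_nseq// => i ni.
    by rewrite nth_mkseq// At ?nth_cat ?size_nseq ?ni// (leq_trans ni) ?leq_addr.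
  rewrite nth_mkseq// /shift At ?ltn_add2l// nth_cat size_nseq.
  by rewrite ltnNge leq_addr /= addKn.
have mA1 : measurable A1 by exact: borel_cylinder.
have mA2 : measurable A2 by exact: borel_cylinder.
have Pn : P (nseq n false) = false by rewrite /P has_nseq andbF.
have A12 : A1 `&` A2 = set0.
  rewrite -subset0 => t [/cylinderE]; rewrite mw => tw /A2E[t0 _].
  by have : P (nseq n false); [rewrite -t0 tw|rewrite Pn].
apply: (@lt_le_trans _ _ (coin (A1 `|` A2))).
  rewrite measureU// [X in X + _]coin_cylinder [X in _ + X]coin_cylinder.
  by rewrite -EFinD lte_fin ltrDl exprn_gt0// invr_gt0.
apply: le_measure.
- by apply: mem_set; exact: measurableU.
- apply: mem_set; apply: open_borel; apply: open_comp => //; exact: cell_open.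
- move=> t [/cylinderE|/A2E[t0 tw]] /=; rewrite /h.
    by rewrite mw => ->; rewrite [P w]Pw; exact: eP.
  by rewrite t0 Pn tw; exact: eP.
Qed.

(** Each word of a deeper level receives a small cell near one of the points of an
    empirical measure close to [mu]. The mass [2^-(n + k)] of every such cell is then
    a lower bound that suffices for all the finitely many inequalities that define
    a neighbourhood of [mu], whatever happens to the mass of the word [0...0]. *)
Lemma measure_refinement (q : condition X P) (O : set (prob_space R X)) : open O ->
  O `&` @measure_box R X q !=set0 ->
  exists2 p, refines p q & @closed_measure_box R X p `<=` O.
Proof.
move=> oO [mu [Omu muq]]; have [L [U [a [oU aU hO]]]] := prob_nbhs oO Omu.
set n := level q in muq.
have mU l : measurable (U l : set (borel (pointed_group X))) by apply: open_borel.
have hd l : exists d : R, (0 < d)%R /\ (a l + d)%:E < mu (U l).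
  exists ((fine (mu (U l)) - a l) / 2)%R.
  have := aU l; rewrite -(@fineK _ (mu (U l))) ?fin_num_measure// !lte_fin => h.
  by split; lra.
pose d l := sval (cid (hd l)).
have dP l : (0 < d l)%R /\ (a l + d l)%:E < mu (U l) by rewrite /d; case: cid.
pose e : R := \big[Order.min/1%R]_l d l.
have e0 : (0 < e)%R by apply: lt_bigmin => // l _; have [] := dP l.
have ed l : (e <= d l)%R by exact: bigmin_le_cond.
pose C (w : n.-tuple bool) : set (borel (pointed_group X)) := cell q w.
have [|||||k [c [c_ne c_ge]]] := @allocation _ _ R mu n L C U e.
- by move=> w; exact: borel_cell.
- exact: mU.
- move=> v w Pv Pw vw; apply: val_inj.
  by apply: (@cell_disjoint _ _ q v w) => //; rewrite size_tuple.
- by move=> w Pw; apply: muq => //; rewrite size_tuple.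
- exact: e0.
pose z := nseq_tuple n false; pose zk := nseq_tuple k false.
pose cs w := c (insubd z (take n w)) (insubd zk (drop n w)).
have csE (w : n.-tuple bool) (v : k.-tuple bool) : cs (w ++ v) = c w v.
  by rewrite /cs take_size_cat ?size_tuple// drop_size_cat ?size_tuple// !valKd.
pose G w := [set x | forall l, cs w l -> U l x].
have [|//||p [pq pN _ pG]] := @refinement _ _ scX hX noiso P P_cat q (n + k) 0 G.
- exact: leq_addr.
- move=> w sw Pw; split; first exact: open_fin_bigcap.
  have st : size (take n w) = n by rewrite size_takel// sw leq_addr.
  have [x [xC xU]] := c_ne (insubd z (take n w)) (insubd zk (drop n w)).
  exists x; split => //=; case: (boolP (P (take n w))) => Pt; last first.
    by rewrite cell_free.
  have vt : val (insubd z (take n w)) = take n w by rewrite val_insubd st eqxx.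
  by move: xC; rewrite /C /= vt; apply.
exists p => // nu nup; apply: hO => l.
pose s := [seq wv : n.-tuple bool * k.-tuple bool <- index_enum _ |
  P (wv.1 ++ wv.2) && c wv.1 wv.2 l].
have ss (wv : n.-tuple bool * k.-tuple bool) : size (wv.1 ++ wv.2) = level p.
  by rewrite size_cat !size_tuple pN.
have sP wv : wv \in s -> P (wv.1 ++ wv.2) /\ c wv.1 wv.2 l.
  by rewrite mem_filter => /andP[/andP[]].
have nu_ge : (2^-1 ^+ (n + k) * (size s)%:R)%:E <= nu (U l).
  apply: (@le_trans _ _ (\sum_(wv <- s) nu (cell p (wv.1 ++ wv.2)))).
    rewrite mulr_natr -iter_addr_0 -(count_predT s) -big_const_seq -sumEFin.
    rewrite !big_seq; apply: lee_sum => wv /sP[Pwv _]; rewrite -pN.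
    exact: nup.
  rewrite -(measure_seqU nu (F := fun wv : n.-tuple bool * k.-tuple bool =>
    (cell p (wv.1 ++ wv.2) : set (borel (pointed_group X))))).
  - apply: le_measure.
    + apply: mem_set; apply: fin_bigcup_measurable => [|v _]; first exact: finite_seq.
      exact: borel_cell.
    + exact: mem_set.
    + move=> x [wv /= /sP[Pwv cl] pwv].
      have /(_ l) := pG _ (etrans (ss wv) pN) Pwv x pwv.
      by rewrite csE; apply.
  - by rewrite filter_uniq// index_enum_uniq.
  - by move=> v _; exact: borel_cell.
  - move=> [w v] [w' v'] /sP[/= Pw _] /sP[/= Pw' _] h.
    have /eqP := @cell_disjoint _ _ p (w ++ v) (w' ++ v') (ss (w, v)) (ss (w', v')) Pw Pw' h.
    by rewrite eqseq_cat ?size_tuple// => /andP[/eqP/val_inj -> /eqP/val_inj ->].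
apply: lt_le_trans nu_ge; rewrite lte_fin.
have := lt_le_trans (dP l).2 (c_ge l); rewrite lte_fin.
have -> : #|[pred wv : n.-tuple bool * k.-tuple bool |
    has id (wv.1 ++ wv.2) && c wv.1 wv.2 l]| = size s.
  by rewrite cardE /enum_mem; congr size.
by have := ed l; lra.
Qed.

End measure_refinement.

(** * Measures: limits of conditions *)

Definition zero_seq : cantor_space := fun=> false.

Lemma coin_zero_seq (R : realType) :
  @coin_measure R [set zero_seq : borel cantor_space] = 0%E.
Proof.
have mz : measurable [set zero_seq : borel cantor_space].
  by apply: closed_borel; exact: hausdorff_closed1 cantor_space_hausdorff.
apply/eqP; rewrite eq_le measure_ge0 andbT; apply/lee_addgt0Pr => e e0; rewrite add0e.
pose n := Num.truncn e^-1.
apply: (@le_trans _ _ (@coin_measure R (cylinder n zero_seq))).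
  apply: le_measure; [exact: mem_set|apply: mem_set|by move=> t ->];
    exact: borel_cylinder.
rewrite [leLHS]coin_cylinder lee_fin exprVn invf_ple ?posrE ?exprn_gt0//.
apply/ltW/(lt_le_trans (truncnS_gt _)); rewrite -natrX ler_nat.
exact: ltn_expl.
Qed.

(** The cylinders of the words [0^i 1] cut the nonzero sequences into countably many
    copies of the Cantor cube. *)
Definition track i := rcons (nseq i false) true.

Lemma track_exists t : t <> zero_seq ->
  exists i, t = prepend (track i) (shift i.+1 t).
Proof.
move=> tz; have ti : exists i, t i.
  apply: contrapT => h; apply: tz; apply/funext => i; apply/negbTE/negP => ti.
  by apply: h; exists i.
exists (ex_minn ti); case: ex_minnP => i it imin.
apply/funext => j; rewrite /prepend /shift size_rcons size_nseq.
case: ltnP => [|ij]; last by rewrite subnKC.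
rewrite ltnS leq_eqVlt nth_rcons size_nseq => /predU1P[->|ji]; first by rewrite ltnn eqxx.
rewrite ji nth_nseq ji; apply/negbTE/negP => /imin; by rewrite leqNgt ji.
Qed.

Section measure_limit.
Variables (R : realType) (X : topologicalZmodType) (sm : nat -> set X -> Prop).
Hypotheses (scX : complete_scale sm) (hX : hausdorff_space X).
Let P : pred (seq bool) := has id.
Let P_cat u v : P u -> P (u ++ v). Proof. by rewrite /P has_cat => ->. Qed.
Let coin := @coin_measure R.
Variable q : nat -> condition X P.
Hypothesis refq : forall k, refines (q k.+1) (q k).
Hypothesis smq : forall k, small sm k (q k).
Variable F : cantor_space -> pointed_group X.
Hypothesis FP : forall k (t : cantor_space), cell (q k) (mkseq t (level (q k))) (F t).
Local Open Scope ereal_scope.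

Lemma nonzero_carries_cell (t : cantor_space) : t <> zero_seq ->
  exists k, P (mkseq t (level (q k))).
Proof.
move=> tz; have [i ti] : exists i, t i.
  apply: contrapT => h; apply: tz; apply/funext => i; apply/negbTE/negP => ti.
  by apply: h; exists i.
exists i.+1; apply/hasP; exists (t i) => //; apply/mapP; exists i => //.
by rewrite mem_iota /= add0n; exact: (smq i.+1).1.
Qed.

Lemma limit_continuous_nonzero (t : cantor_space) : t <> zero_seq ->
  {for t, continuous F}.
Proof.
move=> /nonzero_carries_cell; exact: (limit_continuous scX P_cat refq smq FP).
Qed.

Lemma limit_track_continuous i : continuous (fun t => F (prepend (track i) t)).
Proof.
move=> t; apply: (@continuous_comp _ _ _ (prepend (track i)) F).
  apply: (@coordinatewise_continuous _ 0) => n s s' ss' j jn; rewrite /prepend.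
  by case: ifP => // _; apply: ss'; exact: leq_ltn_trans (leq_subr _ _) jn.
apply: limit_continuous_nonzero => /(congr1 (fun t : cantor_space => t i)).
by rewrite /prepend size_rcons size_nseq ltnSn nth_rcons size_nseq ltnn eqxx.
Qed.

Lemma limit_borel (U : set X) : open U ->
  measurable (F @^-1` U : set (borel cantor_space)).
Proof.
move=> oU; have cz : closed [set zero_seq].
  exact: hausdorff_closed1 cantor_space_hausdorff.
rewrite (_ : F @^-1` U =
  (F @^-1` U `\` [set zero_seq]) `|` (F @^-1` U `&` [set zero_seq])).
  apply: measurableU.
    apply: open_borel; rewrite openE => t [FUt tz].
    have Ft := limit_continuous_nonzero tz.
    apply: filterI; first by apply: Ft; exact: open_nbhs_nbhs.
    by apply: open_nbhs_nbhs; split => //; exact: closed_openC.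
  have [Fz|nFz] := pselect (U (F zero_seq)).
    rewrite setIidr; first exact: closed_borel.
    by move=> _ ->.
  rewrite (_ : _ `&` _ = set0); first exact: measurable0.
  by rewrite -subset0 => t [Ut tz]; apply: nFz; rewrite -tz.
apply/seteqP; split => [t Ut|t [[]|[]]//].
by have [tz|tz] := pselect (t = zero_seq); [right|left].
Qed.

Lemma limit_measure : exists nu : prob_space R X,
  (forall B, nu B = coin (F @^-1` B)) /\ forall k, closed_measure_box (q k) nu.
Proof.
have [|nu nuE] := @pushforward_exists R (pointed_group X) coin F; first exact: limit_borel.
exists nu; split => // k w sw Pw; rewrite nuE.
rewrite -[X in X <= _](coin_cylinder R _ (nth false w)).
apply: le_measure.
- apply: mem_set; exact: borel_cylinder.
- by apply: mem_set; apply: limit_borel; exact: cell_open.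
- move=> t /cylinderE; rewrite -sw mkseq_nth => tw.
  by have := FP k t; rewrite /= -sw tw.
Qed.

(** A measure in all the boxes dominates the image of the coin measure: at level [k]
    the cells over the cylinders meeting [K] carry at least the mass of these
    cylinders, and they decrease to [F @` K]. *)
Lemma limit_domination (y : prob_space R X) (K : set cantor_space) :
  (forall k, measure_box (q k) y) -> closed K -> ~ K zero_seq ->
  closed (F @` K : set X) /\ coin K <= y (F @` K).
Proof.
move=> yq cK Kz.
have cptK : compact K.
  by apply: (@subclosed_compact _ _ [set: cantor_space]) => //; exact: cantor_space_compact.
have cFK : closed (F @` K : set X).
  apply: compact_closed => //; apply: continuous_compact => //.
  apply: continuous_in_subspaceT => t /set_mem Kt; apply: limit_continuous_nonzero => tz.
  by apply: Kz; rewrite -tz.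
split => //.
have [m mK] : exists m, cylinder m zero_seq `<=` ~` K.
  apply: nbhs_cylinder; apply: open_nbhs_nbhs; split => //; exact: closed_openC.
pose s k := [seq w : (level (q (k + m))).-tuple bool <- index_enum _ |
  `[< exists2 t, K t & mkseq t (level (q (k + m))) = w >]].
have sE k w : w \in s k <-> exists2 t, K t & mkseq t (level (q (k + m))) = w.
  rewrite mem_filter mem_index_enum andbT.
  by split=> [/asboolP|h]; [|exact/asboolP].
have sP k w : w \in s k -> P w.
  move=> /sE[t Kt tw]; apply/negPn/negP => nPw; apply: (mK t) => //.
  move=> i im; have il : (i < level (q (k + m)))%N.
    by apply: leq_trans im _; apply: leq_trans (smq (k + m)).1; exact: leq_addl.
  apply/negbTE/negP => ti; move/negP : nPw; apply; rewrite -tw; apply/hasP.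
  by exists (t i) => //; apply/mapP; exists i => //; rewrite mem_iota.
pose W k : set (borel (pointed_group X)) := \bigcup_(w in [set` s k]) cell (q (k + m)) w.
have mW k : measurable (W k).
  by apply: fin_bigcup_measurable => [|w _]; [exact: finite_seq|exact: borel_cell].
have mK' : measurable (K : set (borel cantor_space)) by exact: closed_borel.
have KW k : coin K <= y (W k).
  set l := level (q (k + m)).
  apply: (@le_trans _ _ (coin (\bigcup_(w in [set` s k]) cylinder l (nth false (tval w))))).
    apply: le_measure.
    - exact: mem_set.
    - apply: mem_set; apply: fin_bigcup_measurable => [|w _]; first exact: finite_seq.
      exact: borel_cylinder.
    - move=> t Kt; have lt : size (mkseq t l) == l by rewrite size_mkseq.
      exists (Tuple lt); first by apply/sE; exists t.
      apply/cylinderE => /=.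
      by have := mkseq_nth false (mkseq t l); rewrite size_mkseq.
  rewrite (measure_seqU coin (F := fun w : l.-tuple bool =>
    (cylinder l (nth false w) : set (borel cantor_space)))).
  - rewrite (measure_seqU y (F := fun w : l.-tuple bool =>
      (cell (q (k + m)) w : set (borel (pointed_group X))))).
    + rewrite !big_seq; apply: lee_sum => w /sP Pw.
      rewrite [leLHS]coin_cylinder; apply: ltW; apply: yq => //.
      by rewrite size_tuple.
    + by rewrite filter_uniq// index_enum_uniq.
    + by move=> w _; exact: borel_cell.
    + move=> w w' /sP Pw /sP Pw' h; apply: val_inj.
      by apply: (@cell_disjoint _ _ (q (k + m))) => //; rewrite size_tuple.
  - by rewrite filter_uniq// index_enum_uniq.
  - by move=> w _; exact: borel_cylinder.
  - move=> w w' _ _ [t [/cylinderE tw /cylinderE tw']]; apply: val_inj => /=.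
    have wE (v : l.-tuple bool) : mkseq (nth false v) l = v.
      by have := mkseq_nth false v; rewrite size_tuple.
    by rewrite -(wE w) -tw tw' wE.
have ndW : nonincreasing_seq W.
  apply/nonincreasing_seqP => k; apply/subsetPset => x [w /= /sE[t Kt tw] xw].
  have lk : (level (q (k + m)) <= level (q (k.+1 + m)))%N by rewrite addSn; exact: (refq _).1.
  have lt : size (mkseq t (level (q (k + m)))) == level (q (k + m)) by rewrite size_mkseq.
  exists (Tuple lt); first by apply/sE; exists t.
  rewrite /= -(take_mkseq t lk); apply: (refines_cell (refq (k + m))).
    by rewrite size_mkseq addSn.
  by move: xw; rewrite -tw addSn.
have WFK : \bigcap_k W k = F @` K.
  apply/seteqP; split=> [x hx|_ [t Kt <-] k _]; last first.
    have lt : size (mkseq t (level (q (k + m)))) == level (q (k + m)) by rewrite size_mkseq.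
    by exists (Tuple lt); [apply/sE; exists t|exact: FP].
  apply: cFK => V; rewrite nbhsE => -[U [oU Ux] UV].
  have [k kU] := scale_nbhs scX oU Ux.
  have [w /= ws xw] := hx k I; have [t Kt tw] := (sE k w).1 ws.
  exists (F t); split; first by exists t.
  apply/UV/(kU (cell (q (k + m)) w)) => //; last by rewrite -tw; exact: FP.
  apply: (scale_anti scX (leq_addr m k)); apply: (smq _).2; first by rewrite size_tuple.
  exact: sP ws.
rewrite -WFK.
have cv : y \o W @ \oo --> y (\bigcap_k W k).
  apply: nonincreasing_cvg_mu => //.
    by apply: le_lt_trans (probability_le1 y (mW 0%N)) _; rewrite ltry.
  by apply: bigcap_measurable => // k _.
rewrite -(cvg_lim _ cv)//; apply: lime_ge; first by apply/cvg_ex; eexists; exact: cv.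
by apply: nearW => k; exact: KW.
Qed.

End measure_limit.

(** * Generically Haar-null sets *)

Section null.
Variables (R : realType) (X : topologicalZmodType) (sm : nat -> set X -> Prop).
Hypotheses (scX : complete_scale sm) (hX : hausdorff_space X).
Hypothesis noiso : forall x : X, ~ open [set x].
Let P : pred (seq bool) := has id.
Let P_cat u v : P u -> P (u ++ v). Proof. by rewrite /P has_cat => ->. Qed.
Let coin := @coin_measure R.
Local Open Scope ereal_scope.

Let limit_function (q : nat -> condition X P) :
  (forall k, refines (q k.+1) (q k)) -> (forall k, small sm k (q k)) ->
  exists F : cantor_space -> pointed_group X,
    forall k (t : cantor_space), cell (q k) (mkseq t (level (q k))) (F t).
Proof. by move=> refq smq; exact: (limit_exists scX P_cat refq smq). Qed.

Let trivial_condition : exists q : condition X P, level q = 0%N /\ cell q = fun=> setT.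
Proof. by apply: trivial_condition_exists; exists (0%R : X). Qed.

Let P_track i : P (track i).
Proof. by rewrite /P /track has_rcons. Qed.

(** Negligibility is tested on each track, and transported to the limit measure by
    closed sets that avoid a null Borel set: this is where an arbitrary, possibly
    non-Borel, set [B] is handled. *)
Lemma limit_negligible (q : nat -> condition X P) (F : cantor_space -> pointed_group X)
    (y : prob_space R X) (B : set X) :
  (forall k, refines (q k.+1) (q k)) -> (forall k, small sm k (q k)) ->
  (forall k (t : cantor_space), cell (q k) (mkseq t (level (q k))) (F t)) ->
  (forall k, measure_box (q k) y) ->
  (forall i, coin.-negligible ((fun t => F (prepend (track i) t)) @^-1` B)) ->
  y.-negligible B.
Proof.
move=> refq smq FP yq nB.
pose Z : set (borel cantor_space) := [set zero_seq].
have mZ : measurable Z.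
  by apply: closed_borel; exact: hausdorff_closed1 cantor_space_hausdorff.
have : coin.-negligible (Z `|` F @^-1` B).
  have /negligibleS : (Z `|` F @^-1` B : set (borel cantor_space)) `<=`
      Z `|` \bigcup_i (shift i.+1 @^-1` ((fun t => F (prepend (track i) t)) @^-1` B)).
    move=> t [|Bt]; first by left.
    have [tz|/track_exists[i tE]] := pselect (t = zero_seq); first by left.
    by right; exists i => //=; rewrite -tE.
  apply; apply: negligibleU.
    by apply/negligibleP => //; exact: coin_zero_seq.
  apply: negligible_bigcup => i; have [N [mN N0 BN]] := nB i.
  have mSN : measurable (shift i.+1 @^-1` N : set (borel cantor_space)).
    apply: borel_preimage mN => U oU; apply: open_borel.
    by apply: open_comp => // t _; exact: shift_continuous.
  exists (shift i.+1 @^-1` N); split => //; last by move=> t /BN.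
  by rewrite [LHS]coin_shift.
move=> [N [mN N0 FN]].
have hK n : exists K : set cantor_space,
    [/\ closed K, K `&` N = set0 & (1 - n.+1%:R^-1)%:E <= coin K].
  by apply: negligible_avoiding_closed => //; rewrite invr_gt0 ltr0n.
pose K n := sval (cid (hK n)).
have KP n : [/\ closed (K n), K n `&` N = set0 & (1 - n.+1%:R^-1)%:E <= coin (K n)].
  by rewrite /K; case: cid.
have Kz n : ~ K n zero_seq.
  move=> Kz; have [_ KN _] := KP n.
  have : (K n `&` N) zero_seq by split => //; apply: FN; left.
  by rewrite KN.
have dom n := limit_domination scX hX refq smq FP yq (let: And3 cK _ _ := KP n in cK) (Kz n).
have mFK n : measurable (F @` K n : set (borel (pointed_group X))).
  by apply: closed_borel; exact: (dom n).1.
pose D := \bigcap_n ~` (F @` K n : set (borel (pointed_group X))).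
have mD : measurable D by apply: bigcap_measurable => // n _; exact: measurableC.
exists D; split => //.
  apply/eqP; rewrite eq_le measure_ge0 andbT; apply/lee_addgt0Pr => e e0; rewrite add0e.
  pose n := Num.truncn e^-1.
  apply: (@le_trans _ _ (y (~` (F @` K n : set (borel (pointed_group X)))))).
    apply: le_measure; [exact: mem_set|by apply: mem_set; exact: measurableC|].
    by move=> x; apply.
  rewrite probability_setC//.
  apply: (@le_trans _ _ (1 - (1 - n.+1%:R^-1)%:E)).
    rewrite leeB//; apply: le_trans (dom n).2.
    by have [] := KP n.
  rewrite -EFinB lee_fin opprB addrC subrK invf_ple ?posrE ?ltr0n//.
  exact/ltW/truncnS_gt.
move=> b Bb n _ [t Kt Ft]; have [_ KN _] := KP n.
have : (K n `&` N) t by split => //; apply: FN; right; rewrite /= Ft.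
by rewrite KN.
Qed.

(** Dropping the first digit preserves the coin measure, and any sequence can be
    made to begin with [1] by flipping its first digit, which preserves the coin
    measure too. So a null set of the limit measure stays null when it is pulled
    back along the part of the limit map that lives on the cylinder of [1]. *)
Lemma negligible_first_track (F : cantor_space -> pointed_group X)
    (g : cantor_space -> X) (nu : prob_space R X) (B : set X) :
  continuous g ->
  (forall U : set X, open U -> measurable (F @^-1` U : set (borel cantor_space))) ->
  (forall t, g t = F (prepend [:: true] t)) ->
  (forall C, nu C = coin (F @^-1` C)) ->
  nu.-negligible B -> coin.-negligible (g @^-1` B).
Proof.
move=> cg mF gF nuE [C [mC C0 BC]].
have mFC : measurable (F @^-1` C : set (borel cantor_space)) by exact: borel_preimage mC.
have mgC : measurable (g @^-1` C : set (borel cantor_space)).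
  apply: (@borel_preimage _ (borel cantor_space) (pointed_group X) g C) => // U oU.
  by apply: open_borel; exact: open_comp.
exists (g @^-1` C); split => //; last by move=> t /BC.
rewrite -[LHS](coin_shift R 1)//.
have mflip : measurable (flip @^-1` (F @^-1` C) : set (borel cantor_space)).
  apply: borel_preimage mFC => U oU; apply: open_borel.
  by apply: open_comp => // t _; exact: flip_continuous.
have mshift : measurable (shift 1 @^-1` (g @^-1` C) : set (borel cantor_space)).
  apply: borel_preimage mgC => U oU; apply: open_borel.
  by apply: open_comp => // t _; exact: shift_continuous.
apply/eqP; rewrite eq_le measure_ge0 andbT.
apply: (@le_trans _ _ (coin ((F @^-1` C) `|` (flip @^-1` (F @^-1` C))))).
  apply: le_measure; [exact: mem_set|by apply: mem_set; exact: measurableU|].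
  move=> t; rewrite /= gF => FC.
  have tE : prepend [:: true] (shift 1 t) = if t 0%N then t else flip t.
    apply/funext => -[|i]; rewrite /prepend /shift /flip /= ?subn1; case t0: (t 0%N) => //.
  by move: FC; rewrite tE; case: ifP => _; [left|right].
have h1 : coin (F @^-1` C) <= 0 by rewrite -nuE [leLHS]C0.
have h2 : coin (flip @^-1` (F @^-1` C)) <= 0 by rewrite [leLHS]coin_flip.
by apply: le_trans (measureU2 coin mFC mflip) _; rewrite -[leRHS]adde0; exact: leeD.
Qed.

(** The two sides are linked as for compact sets, with the limit map of a descending
    sequence and the image of the coin measure under it. Towards measures, all the
    tracks of the limit map are made to enter the given dense open sets; in the
    other direction, the first track is the given map. *)
Lemma generically_Haar_null_measures (A : set X) :
  generically_Haar_null A R <-> comeager (null_measures A R).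
Proof.
have [q0 [q00 q0T]] := trivial_condition.
have denseT : dense [set: cantor_maps X] by move=> O [g Og] _; exists g.
have small_box k i (q : condition X P) D : open D -> dense D ->
    exists2 p, refines p q & small sm k p /\ box (track i) p `<=` D.
  move=> oD dD; have [|p [pq sp pD]] := box_refinement scX hX noiso P_cat (P_track i)
    (q := q) k oD; last by exists p.
  by rewrite setIC; apply: dD; [exact: box_neq0|exact: open_box].
split=> [/comeager_bigcap_open[D oD DA]|/comeager_bigcap_open[D oD DA]].
- (* The natural number [j] codes the requirement that the [i]-th track of the
     limit map enters [D k]; all of them are to be met by one sequence. *)
  pose E j : set (condition X P) := [set q | small sm j q /\
    if @choice.unpickle (nat * nat)%type j is Some ik
    then box (track ik.1) q `<=` D ik.2 else True].
  apply: comeagerS (comeager_descending (Q := condition X P)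
    (le := @refines X P) (V := @measure_box R X) (D := E) (top := q0)
    _ _ _ _ _ _ _).
  + move=> y [q hq] x.
    have refq k : refines (q k.+1) (q k) by have [] := hq k.
    have smq k : small sm k (q k) by have [_ []] := hq k.
    have yq k : measure_box (q k) y by have [] := hq k.
    have [F FP] := limit_function refq smq.
    apply: (limit_negligible refq smq FP yq) => i.
    have ci : continuous ((fun t => F (prepend (track i) t)) : cantor_space -> X).
      exact: (limit_track_continuous scX refq smq FP).
    pose g : cantor_maps X := mkcts ci.
    have gq k : box (track i) (q k) g by move=> t; exact: FP.
    have /DA Ag : (\bigcap_k D k) g; last exact: Ag.
    move=> k _; have [_ [_ +] _] := hq (choice.pickle (i, k)).
    by rewrite choice.pickleK /=; apply.
  + exact: refines_trans.
  + exact: open_measure_box.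
  + exact: measure_box_neq0.
  + exact: refines_measure_box.
  + apply/seteqP; split => // mu _ w; rewrite q00 => /size0nil -> //.
  + move=> q O oO Oq; have [p pq pO] := measure_refinement scX hX noiso oO Oq.
    by exists p => // nu nup; apply: pO => w sw Pw; exact/ltW/nup.
  + move=> j q; rewrite /E; case: choice.unpickle => [[i k]|] /=.
      by have [oDk dDk] := oD k; exact: small_box.
    by have [p pq [sp _]] := small_box j 0%N q setT openT denseT; exists p.
- apply: comeagerS (comeager_descending (Q := condition X P)
    (le := @refines X P) (V := @box X P (track 0))
    (D := fun k => [set q | small sm k q /\ @closed_measure_box R X q `<=` D k]) (top := q0)
    _ _ _ _ _ _ _).
  + move=> g [q hq] x.
    have refq k : refines (q k.+1) (q k) by have [] := hq k.
    have smq k : small sm k (q k) by have [_ []] := hq k.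
    have [F FP] := limit_function refq smq.
    have [nu [nuE nuq]] := limit_measure R scX refq smq FP.
    have gF t : g t = F (prepend (track 0) t).
      apply: (limit_unique scX hX P_cat refq smq FP) => [|k]; last first.
        by have [_ _] := hq k; apply.
      apply: (nonzero_carries_cell smq) => /(congr1 (fun t : cantor_space => t 0%N)).
      by [].
    have /DA Anu : (\bigcap_k D k) nu by move=> k _; have [_ [_ qD] _] := hq k; exact: qD.
    apply: (negligible_first_track _ (limit_borel scX refq smq FP) gF nuE (Anu x)).
    exact: cantor_maps_continuous.
  + exact: refines_trans.
  + exact: open_box.
  + exact: box_neq0.
  + exact: refines_box.
  + by apply/seteqP; split => // g _; rewrite /box /= q0T.
  + move=> q O oO Oq; have [p [pq _ pO]] :=
      box_refinement scX hX noiso P_cat (P_track 0) 0 oO Oq; by exists p.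
  + move=> k q; have [oDk dDk] := oD k.
    have [|p pq pD] := measure_refinement scX hX noiso (q := q) oDk.
      by rewrite setIC; apply: dDk; [exact: measure_box_neq0|exact: open_measure_box].
    have [r rp [sr _]] := small_box k 0%N p setT openT denseT.
    exists r; first exact: refines_trans rp pq.
    split => //; apply: subset_trans pD; exact: refines_closed_measure_box.
Qed.

End null.

Theorem theorem16p9 (R : realType) (X : topologicalZmodType) (A : set X)
    (polishX : polish R X) (nondiscreteX : ~ discrete_space X) :
  [/\ generically_Haar_null A R <-> comeager (null_measures A R),
      generically_Haar_meager A <-> comeager (compacts_meager A),
      generically_Haar_countable A <-> comeager (compacts_countable A),
      generically_Haar_finite A <-> comeager (compacts_finite A) &
      forall n : nat, (0 < n)%N ->
        (generically_Haar_n A n <-> comeager (compacts_le A n))].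
Proof.
have [_ /completely_metrizable_scale[hX [sm scX]]] := polishX.
split.
- apply: (generically_Haar_null_measures R scX hX).
  exact: nondiscrete_no_isolated.
- exact: (generically_Haar_meager_compacts A polishX nondiscreteX).
- exact: (generically_Haar_countable_compacts A polishX nondiscreteX).
- exact: (generically_Haar_finite_compacts A polishX nondiscreteX).
- by move=> n _; exact: (generically_Haar_n_compacts A polishX nondiscreteX n).
Qed.
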